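(* Let $n,m\in\mathbb{N}$. The Schützenberger groups of $M_{n\times m}(\mathbb{T})$ are, up to isomorphism, exactly the groups of the form $$\prod_{\alpha=1}^z\bigl((\mathbb{R}\times G_\alpha)\wr\mathcal{S}_{h_\alpha}\bigr)$$ with $z\in\mathbb{N}$, $h_\alpha\in\mathbb{N}$ and $G_\alpha$ finite groups, where for each $1\le\alpha\le z$ there exist $n_\alpha,m_\alpha\in\mathbb{N}$ such that (i) $\sum_{\alpha=1}^z n_\alpha h_\alpha\le n$; (ii) $\sum_{\alpha=1}^z m_\alpha h_\alpha\le m$; (iii) each $G_\alpha$ is paired 2-closed on $n_\alpha$ and $m_\alpha$ points; (iv) at most one $\alpha$ has $\min(n_\alpha,m_\alpha)=1$; and (v) if $G_{\alpha_1},G_{\alpha_2},G_{\alpha_3}$ are trivial for distinct $\alpha_1,\alpha_2,\alpha_3$, then $\min(n_{\alpha_i},m_{\alpha_i})>2$ for some $i$.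
   Context: $\mathbb{N}$ is the set of positive integers. $\mathbb{T} = \mathbb{R}\cup\{-\infty\}$ is the tropical semiring, with $\oplus = \max$ and $\otimes = +$. $M(\mathbb{T})$ is the category of all matrices of any (positive) size over $\mathbb{T}$, with tropical matrix multiplication whenever sizes are compatible; $M_{n\times m}(\mathbb{T})$ is the set of $n\times m$ matrices. Write $S=M(\mathbb{T})$. For $a,b\in S$: $a\mathrel{\mathcal{R}}b$ if $aS=bS$, $a\mathrel{\mathcal{L}}b$ if $Sa=Sb$ (all products that are defined), and $a\mathrel{\mathcal{H}}b$ if both hold. $\mathcal{H}$-related matrices have the same size. For an $\mathcal{H}$-class $H$ and $s\in S$ such that $sh$ is defined for all $h\in H$ and $sH\subseteq H$, let $\phi_s\colon H\to H$, $a\mapsto sa$. The (left) Schützenberger group of $H$ is $\Gamma_H=\{\phi_s : s\in S,\ sH\subseteq H\}$, a group under composition; the right Schützenberger group, defined dually, is isomorphic to it. The Schützenberger groups of $M_{n\times m}(\mathbb{T})$ are the groups $\Gamma_H$ where $H$ is an $\mathcal{H}$-class of $M(\mathbb{T})$ contained in $M_{n\times m}(\mathbb{T})$. $\mathbb{R}$ denotes the additive group of real numbers, $\mathcal{S}_h$ is the symmetric group on $\{1,\dots,h\}$, and $K\wr\mathcal{S}_h=K^h\rtimes\mathcal{S}_h$ with $\mathcal{S}_h$ permuting the coordinates. Paired 2-closed: let $G$ be a finite group with faithful actions on finite sets $\Omega$ and $\Gamma$, regarded as a subgroup of $\mathcal{S}_\Omega\times\mathcal{S}_\Gamma$ (where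 $\mathcal{S}_X$ is the symmetric group on a set $X$) via the diagonal action of these two actions. $G$ is paired 2-closed on $\Omega$ and $\Gamma$ if $G$ contains every element of $\mathcal{S}_\Omega\times\mathcal{S}_\Gamma$ which preserves each $G$-orbit of pairs in $\Omega\times\Gamma$. $G$ is paired 2-closed on $n$ and $m$ points if it is so for some such faithful actions with $|\Omega|=n$ and $|\Gamma|=m$.
   Formalization: The H-class of the all −∞ matrix is excluded from the classification, since its Schützenberger group is trivial while every product with z ≥ 1 contains a copy of ℝ; its triviality is proved separately. *)

(* Defs.v *)
From HB Require Import structures.
From mathcomp Require Import all_boot all_order all_algebra all_fingroup.
From mathcomp Require Import boolp classical_sets reals.

Set Implicit Arguments.
Unset Strict Implicit.
Unset Printing Implicit Defensive.

Import Order.TTheory GRing.Theory Num.Theory.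

(* [None] is -oo; the semiring operations are max and +, so that the semiring
   0 is -oo, the semiring 1 is the real number 0, and [*m] is the tropical
   matrix product. *)
Definition tropical (R : Type) : Type := option R.

Section TropicalSemiring.
Variable R : realType.
Local Open Scope ring_scope.
Implicit Types x y z : tropical R.

HB.instance Definition _ := Choice.on (tropical R).

Definition trop_add x y : tropical R :=
  match x, y with
  | Some a, Some b => Some (Num.max a b)
  | None, _ => y
  | _, None => x
  end.

Definition trop_mul x y : tropical R :=
  match x, y with
  | Some a, Some b => Some (a + b)
  | _, _ => None
  end.

Fact trop_addA : associative trop_add.
Proof. by case=> [a|] [b|] [c|] //=; rewrite maxA. Qed.

Fact trop_addC : commutative trop_add.
Proof. by case=> [a|] [b|] //=; rewrite maxC. Qed.

Fact trop_add0 : left_id (None : tropical R) trop_add.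
Proof. by case. Qed.

Fact trop_mulA : associative trop_mul.
Proof. by case=> [a|] [b|] [c|] //=; rewrite addrA. Qed.

Fact trop_mulC : commutative trop_mul.
Proof. by case=> [a|] [b|] //=; rewrite addrC. Qed.

Fact trop_mul1 : left_id (Some 0 : tropical R) trop_mul.
Proof. by case=> [a|] //=; rewrite add0r. Qed.

Fact trop_mulDl : left_distributive trop_mul trop_add.
Proof. by case=> [a|] [b|] [c|] //=; rewrite addr_maxl. Qed.

Fact trop_mul0 : left_zero (None : tropical R) trop_mul.
Proof. by []. Qed.

Fact trop_1neq0 : (Some 0 : tropical R) != None.
Proof. by []. Qed.

HB.instance Definition _ := GRing.isNmodule.Build (tropical R)
  trop_addA trop_addC trop_add0.

HB.instance Definition _ := GRing.Nmodule_isComNzSemiRing.Build (tropical R)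
  trop_mulA trop_mulC trop_mul1 trop_mulDl trop_mul0 trop_1neq0.

End TropicalSemiring.

Section Green.
Variable R : realType.
Local Open Scope ring_scope.
Local Open Scope classical_set_scope.
Local Notation T := (tropical R).

(* aS = bS, one size of products at a time. Matrices with different numbers of
   rows are never R-related, and dually for L. *)
Definition greenR (n m m' : nat) (A : 'M[T]_(n, m)) (B : 'M[T]_(n, m')) : Prop :=
  forall k : nat, (0 < k)%N ->
    [set A *m X | X in [set: 'M[T]_(m, k)]] =
    [set B *m X | X in [set: 'M[T]_(m', k)]].

Definition greenL (n n' m : nat) (A : 'M[T]_(n, m)) (B : 'M[T]_(n', m)) : Prop :=
  forall k : nat, (0 < k)%N ->
    [set X *m A | X in [set: 'M[T]_(k, n)]] =
    [set X *m B | X in [set: 'M[T]_(k, n')]].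

Definition greenH (n m : nat) (A B : 'M[T]_(n, m)) : Prop :=
  greenR A B /\ greenL A B.

Definition Hclass (n m : nat) (A : 'M[T]_(n, m)) : set 'M[T]_(n, m) :=
  [set B | greenH A B].

(* The inclusion sH `<=` H forces s to be square, since H consists of matrices
   of a single size. *)
Definition translations (n m : nat) (H : set 'M[T]_(n, m)) : set (H -> H) :=
  [set f | exists2 s : 'M[T]_n,
     [set s *m B | B in H] `<=` H &
     forall x : H, \val (f x) = s *m \val x].
Arguments translations {n m} H _.

Definition schutzenberger (n m : nat) (A : 'M[T]_(n, m)) : Type :=
  translations (Hclass A).

Section SchutzenbergerGroup.
Variables (n m : nat).

Section Lemmas.
Variable A : 'M[T]_(n, m).

Fact greenR_mul p q r (B : 'M[T]_(p, q)) (C : 'M[T]_(p, r)) :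
  (0 < q)%N -> (0 < r)%N ->
  greenR B C <-> (exists X, B = C *m X) /\ (exists Y, C = B *m Y).
Proof.
move=> q0 r0; split=> [BC|[[X BX] [Y CY]] k k0].
  split.
    have : [set B *m X | X in [set: 'M[T]_q]] B by exists 1%:M; rewrite ?mulmx1.
    by rewrite (BC _ q0) => -[X _ <-]; exists X.
  have : [set C *m X | X in [set: 'M[T]_r]] C by exists 1%:M; rewrite ?mulmx1.
  by rewrite -(BC _ r0) => -[X _ <-]; exists X.
apply/seteqP; split=> _ [Z _ <-].
  by exists (X *m Z) => //; rewrite mulmxA -BX.
by exists (Y *m Z) => //; rewrite mulmxA -CY.
Qed.

Fact greenL_mul p q r (B : 'M[T]_(q, p)) (C : 'M[T]_(r, p)) :
  (0 < q)%N -> (0 < r)%N ->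
  greenL B C <-> (exists X, B = X *m C) /\ (exists Y, C = Y *m B).
Proof.
move=> q0 r0; split=> [BC|[[X BX] [Y CY]] k k0].
  split.
    have : [set X *m B | X in [set: 'M[T]_q]] B by exists 1%:M; rewrite ?mul1mx.
    by rewrite (BC _ q0) => -[X _ <-]; exists X.
  have : [set X *m C | X in [set: 'M[T]_r]] C by exists 1%:M; rewrite ?mul1mx.
  by rewrite -(BC _ r0) => -[X _ <-]; exists X.
apply/seteqP; split=> _ [Z _ <-].
  by exists (Z *m X) => //; rewrite -mulmxA -BX.
by exists (Z *m Y) => //; rewrite -mulmxA -CY.
Qed.

Fact Hclass_refl : Hclass A A. Proof. by split=> k. Qed.

Fact translations_id : translations (Hclass A) id.
Proof.
by exists 1%:M => [_ [B HB <-]|x]; rewrite mul1mx.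
Qed.

Fact translations_comp (f g : Hclass A -> Hclass A) :
  translations (Hclass A) f -> translations (Hclass A) g ->
  translations (Hclass A) (f \o g).
Proof.
move=> [s sH fs] [t tH gt]; exists (s *m t) => [_ [B HB <-]|x /=].
  by rewrite -mulmxA; apply: sH; exists (t *m B) => //; apply: tH; exists B.
by rewrite fs gt mulmxA.
Qed.

Fact translations_inv (f : Hclass A -> Hclass A) :
  translations (Hclass A) f ->
  exists g : translations (Hclass A),
    \val g \o f = id /\ f \o \val g = id.
Proof.
have [n0|n0] := posnP n; last have [m0|m0] := posnP m.
- have HU (x y : Hclass A) : x = y.
    apply/val_inj/matrixP => -[i lti]; exfalso; by rewrite n0 in lti.
  move=> _; exists (SigSub (mem_set translations_id)).
  by split; apply/funext => x; apply: HU.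
- have HU (x y : Hclass A) : x = y.
    apply/val_inj/matrixP => i [j ltj]; exfalso; by rewrite m0 in ltj.
  move=> _; exists (SigSub (mem_set translations_id)).
  by split; apply/funext => x; apply: HU.
move=> [s sH fs].
have HP B C : Hclass A B -> Hclass A C -> greenH B C.
  move=> [r1 l1] [r2 l2]; split=> k k0; first by rewrite -(r1 k k0) (r2 k k0).
  by rewrite -(l1 k k0) (l2 k k0).
have AH := Hclass_refl.
have sAH : Hclass A (s *m A) by apply: sH; exists A.
have [_ /(greenL_mul _ _ n0 n0)[[t At] _]] := sAH.
have tsH B : Hclass A B -> t *m (s *m B) = B.
  move=> /(HP _ _ AH)[/(greenR_mul _ _ m0 m0)[_ [Y ->]] _].
  by rewrite (mulmxA s) (mulmxA t) -At.
have stH B : Hclass A B -> s *m (t *m B) = B.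
  move=> /(HP _ _ sAH)[/(greenR_mul _ _ m0 m0)[_ [Y ->]] _].
  by rewrite (mulmxA t (s *m A)) -At mulmxA.
have tH B : Hclass A B -> Hclass A (t *m B).
  move=> HB; have [/(greenR_mul _ _ m0 m0)[[X sAX] [Y BY]] _] := HP _ _ sAH HB.
  split.
    apply/(greenR_mul _ _ m0 m0); split; last first.
      by exists Y; rewrite BY (mulmxA t) -At.
    by exists X; rewrite -mulmxA -sAX -At.
  have BtB : greenL B (t *m B).
    apply/(greenL_mul _ _ n0 n0); split; last by exists t.
    by exists s; rewrite stH.
  by move=> k k0; rewrite (HB.2 k k0) (BtB k k0).
pose g (x : Hclass A) : Hclass A :=
  SigSub (mem_set (tH _ (set_mem (valP x)))).
have gP : translations (Hclass A) g by exists t => // _ [B HB <-]; exact: (tH B HB).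
exists (SigSub (mem_set gP)); split; apply/funext => x; apply: val_inj => /=.
  by rewrite fs tsH //; apply: set_mem (valP x).
by rewrite fs stH //; apply: set_mem (valP x).
Qed.

End Lemmas.

Variable A : 'M[T]_(n, m).
Implicit Types f g : schutzenberger A.

HB.instance Definition _ := Choice.on (schutzenberger A).

Definition schutz_one : schutzenberger A :=
  SigSub (mem_set (translations_id A)).

Definition schutz_mul f g : schutzenberger A :=
  SigSub (mem_set (translations_comp (set_mem (valP f)) (set_mem (valP g)))).

Definition schutz_inv f : schutzenberger A :=
  projT1 (cid (translations_inv (set_mem (valP f)))).

Fact schutz_mulA : associative schutz_mul.
Proof. by move=> f g h; apply: val_inj. Qed.

Fact schutz_mul1 : left_id schutz_one schutz_mul.
Proof. by move=> f; apply: val_inj. Qed.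

Fact schutz_mulr1 : right_id schutz_one schutz_mul.
Proof. by move=> f; apply: val_inj. Qed.

Fact schutz_mulV : left_inverse schutz_one schutz_inv schutz_mul.
Proof. by move=> f; apply: val_inj; rewrite /= /schutz_inv; case: cid => g []. Qed.

Fact schutz_mulrV : right_inverse schutz_one schutz_inv schutz_mul.
Proof. by move=> f; apply: val_inj; rewrite /= /schutz_inv; case: cid => g []. Qed.

HB.instance Definition _ := isGroup.Build (schutzenberger A)
  schutz_mulA schutz_mul1 schutz_mulr1 schutz_mulV schutz_mulrV.

End SchutzenbergerGroup.
End Green.

Section DirectProduct.
Variables (I : Type) (K : I -> groupType).
Local Open Scope group_scope.

Definition direct_prod_of : Type := forall i, K i.
Implicit Types f g : direct_prod_of.

HB.instance Definition _ := gen_eqMixin direct_prod_of.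
HB.instance Definition _ := gen_choiceMixin direct_prod_of.

Definition dprod_one : direct_prod_of := fun=> 1.
Definition dprod_inv f : direct_prod_of := fun i => (f i)^-1.
Definition dprod_mul f g : direct_prod_of := fun i => f i * g i.

Fact dprod_mulA : associative dprod_mul.
Proof. by move=> f g h; apply: functional_extensionality_dep => i; apply: mulgA. Qed.

Fact dprod_mul1 : left_id dprod_one dprod_mul.
Proof. by move=> f; apply: functional_extensionality_dep => i; apply: mul1g. Qed.

Fact dprod_mulr1 : right_id dprod_one dprod_mul.
Proof. by move=> f; apply: functional_extensionality_dep => i; apply: mulg1. Qed.

Fact dprod_mulV : left_inverse dprod_one dprod_inv dprod_mul.
Proof. by move=> f; apply: functional_extensionality_dep => i; apply: mulVg. Qed.

Fact dprod_mulrV : right_inverse dprod_one dprod_inv dprod_mul.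
Proof. by move=> f; apply: functional_extensionality_dep => i; apply: mulgV. Qed.

HB.instance Definition _ := isGroup.Build direct_prod_of
  dprod_mulA dprod_mul1 dprod_mulr1 dprod_mulV dprod_mulrV.

End DirectProduct.

(* In MathComp (s * t) i = t (s i), so s sends the coordinate family g to g \o s
   as a left action of 'S_h. *)
Record wreath (K : groupType) (h : nat) :=
  Wreath { wreath_base : {ffun 'I_h -> K}; wreath_perm : 'S_h }.

Section WreathProduct.
Variables (K : groupType) (h : nat).
Local Open Scope group_scope.
Implicit Types u v w : wreath K h.

Let to_pair u := (wreath_base u, wreath_perm u).
Let of_pair (p : {ffun 'I_h -> K} * 'S_h) := Wreath p.1 p.2.
Fact wreath_pairK : cancel to_pair of_pair. Proof. by case. Qed.
HB.instance Definition _ := Choice.copy (wreath K h) (can_type wreath_pairK).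

Definition wreath_one : wreath K h := Wreath 1 1.

Definition wreath_mul u v : wreath K h :=
  Wreath [ffun i => wreath_base u i * wreath_base v (wreath_perm u i)]
         (wreath_perm u * wreath_perm v).

Definition wreath_inv u : wreath K h :=
  Wreath [ffun i => (wreath_base u ((wreath_perm u)^-1 i))^-1]
         (wreath_perm u)^-1.

Fact wreath_mulA : associative wreath_mul.
Proof.
move=> [f s] [g t] [k u]; congr Wreath; last exact: mulgA.
by apply/ffunP => i; rewrite !ffunE /= permM mulgA.
Qed.

Fact wreath_mul1 : left_id wreath_one wreath_mul.
Proof.
move=> [f s]; congr Wreath; last exact: mul1g.
by apply/ffunP => i; rewrite !ffunE /= perm1 mul1g.
Qed.

Fact wreath_mulr1 : right_id wreath_one wreath_mul.
Proof.
move=> [f s]; congr Wreath; last exact: mulg1.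
by apply/ffunP => i; rewrite !ffunE /= mulg1.
Qed.

Fact wreath_mulV : left_inverse wreath_one wreath_inv wreath_mul.
Proof.
move=> [f s]; congr Wreath; last exact: mulVg.
by apply/ffunP => i; rewrite !ffunE /= mulVg.
Qed.

Fact wreath_mulrV : right_inverse wreath_one wreath_inv wreath_mul.
Proof.
move=> [f s]; congr Wreath; last exact: mulgV.
by apply/ffunP => i; rewrite !ffunE /= permK mulgV.
Qed.

HB.instance Definition _ := isGroup.Build (wreath K h)
  wreath_mulA wreath_mul1 wreath_mulr1 wreath_mulV wreath_mulrV.

End WreathProduct.

Definition isomorphic (G K : groupType) : Prop :=
  exists f : {multiplicative G -> K}, bijective f.

Section Paired2Closed.
Variables (gT : finGroupType) (Omega Gamma : finType).
Variables (to1 : {action gT &-> Omega}) (to2 : {action gT &-> Gamma}).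

Definition pair_orbit (p : Omega * Gamma) : {set Omega * Gamma} :=
  [set (to1 p.1 g, to2 p.2 g) | g in [set: gT]].

Definition preserves_pair_orbits (s : {perm Omega}) (t : {perm Gamma}) : Prop :=
  forall p, [set (s q.1, t q.2) | q in pair_orbit p] = pair_orbit p.

Definition paired_2closed : Prop :=
  forall (s : {perm Omega}) (t : {perm Gamma}), preserves_pair_orbits s t ->
    exists g : gT, actperm to1 g = s /\ actperm to2 g = t.

End Paired2Closed.

Definition paired_2closed_on_points (gT : finGroupType) (n m : nat) : Prop :=
  exists (Omega Gamma : finType)
         (to1 : {action gT &-> Omega}) (to2 : {action gT &-> Gamma}),
    [/\ #|Omega| = n, #|Gamma| = m,
        [faithful [set: gT], on [set: Omega] | to1],
        [faithful [set: gT], on [set: Gamma] | to2] &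
        paired_2closed to1 to2].

(* Main.v *)
Require Import Defs.
From HB Require Import structures.
From mathcomp Require Import all_boot all_order all_algebra all_fingroup.
From mathcomp Require Import boolp classical_sets reals.
From mathcomp Require Import ring lra.

Set Implicit Arguments.
Unset Strict Implicit.
Unset Printing Implicit Defensive.

Import Order.TTheory GRing.Theory Num.Theory.

(** A matrix [A] over the tropical semiring can be cut down to a matrix [B]
    whose rows generate the row space of [A], whose columns generate its column
    space, and in which no row or column is a combination of the others.  A
    translation in the Schutzenberger group of [A] is an automorphism of the
    column space and, through the matching right multiplication, of the row
    space.  Both automorphisms permute the extremal rays, so the group is that of
    the monomial maps (permutations with scalings) which carry [B] to itself:
    this is [schutzenberger_aut_group], with [reduction_exists] for the existence
    of [B].

    The bipartite graph of the finite entries of [B] splits it into connected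
    blocks.  A monomial automorphism permutes the blocks and can exchange only
    those that are equivalent, whence the wreath products.  In a connected block
    an automorphism which permutes nothing is a constant scaling, and the
    scalings which accompany the finite permutation group [G] of the block can be
    averaged away (the first cohomology of a finite group in a real vector space
    vanishes); so a block contributes a factor [R * G].  This is
    [block_decomposition], [symmetrize] and [wreath_aut_group].  The normalised
    block is constant on the [G]-orbits of pairs, so that every pair of
    permutations which preserves these orbits is a symmetry of the block: [G] is
    paired 2-closed on its rows and columns.  An irredundant block with one row
    or column is a single entry, and one with two rows or columns is two by two;
    when the latter has no symmetry it has exactly one infinite entry.  All
    blocks of either kind are equivalent, and this gives the two conditions on
    small blocks ([small_trivial_equiv]).

    Conversely it suffices to find, for each given group, a connected irredundant
    block with this group of symmetries and not more rows and columns than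
    allowed, such that distinct groups get inequivalent blocks
    ([blocks_exist]).  For trivial groups there are triangular blocks of size
    one, two and three, the last with a free real parameter.  For a nontrivial
    group [G] acting on [X] and [Y] the candidates are the real matrices which
    are constant on the orbits of pairs.  Such a matrix may be redundant whatever
    its values (three columns fixed by [G] can already be too many), so the
    actions are first shrunk as far as the closure property permits
    ([shrink_pair]): this removes fixed points and repeated orbits.  Then an
    irredundant invariant matrix exists ([base_matrix]); it has maximum [0] in
    every row and column and constant column sums, which makes comparisons
    between columns fail in both directions.  Irredundance is an open condition,
    so the values can be moved into general position; after recentering the rows
    and columns, which cancels all scalings, generic values tell the orbits of
    pairs apart, apart from those which fill a whole product of orbits, and a
    symmetry must then preserve every orbit ([rigid_matrix_exists]).  Paired
    2-closedness says that it comes from [G].  Multiplying the matrix by a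
    positive real is an automorphism of the semiring; it is used to give distinct
    groups distinct values of an invariant, the greatest cross difference. *)

Local Notation "a %:T" := (Some a : tropical _) : ring_scope.

(** * The order of the tropical semiring *)

Section TropicalOrder.
Variable R : realType.
Local Open Scope ring_scope.
Local Notation T := (tropical R).
Implicit Types x y z : T.

Definition trop_le x y : bool :=
  match x, y with
  | None, _ => true
  | Some _, None => false
  | Some a, Some b => a <= b
  end.

Fact trop_le_refl : reflexive trop_le.
Proof. by case=> //= a. Qed.

Fact trop_le_anti : antisymmetric trop_le.
Proof. by case=> [a|] [b|] //= ab; congr Some; apply: le_anti. Qed.

Fact trop_le_trans : transitive trop_le.
Proof. by case=> [b|] [a|] [c|] //=; apply: le_trans. Qed.

HB.instance Definition _ := @Order.Le_isPOrder.Build ring_display (tropical R)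
  trop_le trop_le_refl trop_le_anti trop_le_trans.

Fact trop_le_total : total (<=%O : rel T).
Proof. by case=> [a|] [b|] //=; apply: le_total. Qed.

HB.instance Definition _ :=
  Order.POrder_isTotal.Build ring_display (tropical R) trop_le_total.

Lemma trop_leE (a b : R) : (a%:T <= b%:T) = (a <= b). Proof. by []. Qed.

Lemma trop_ltE (a b : R) : (a%:T < b%:T) = (a < b).
Proof. by rewrite ltNge trop_leE -ltNge. Qed.

Lemma trop_le0x x : (0 : T) <= x. Proof. by []. Qed.

Lemma trop_lex0 x : (x <= (0 : T)) = (x == 0). Proof. by case: x. Qed.

Lemma trop_lt0x x : ((0 : T) < x) = (x != 0).
Proof. by rewrite ltNge trop_lex0. Qed.

Lemma trop_mulE (a b : R) : a%:T * b%:T = Some (a + b).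
Proof. by []. Qed.

Lemma trop_neq0 x : x != 0 -> exists a : R, x = Some a.
Proof. by case: x => // a _; exists a. Qed.

Lemma trop_add_le x y z : (x + y <= z) = (x <= z) && (y <= z).
Proof.
case: x y z => [a|] [b|] [c|] //=; rewrite ?andbT //.
by change (Num.max a b <= c = (a <= c) && (b <= c)); rewrite ge_max.
Qed.

Lemma trop_sum_le (I : finType) (F : I -> T) y :
  \sum_i F i <= y <-> forall i, F i <= y.
Proof.
suff E (r : seq I) : (\sum_(i <- r) F i <= y) = all (fun i => F i <= y) r.
  rewrite E; split=> [/allP H i|H]; first by apply: H; rewrite mem_index_enum.
  by apply/allP => i _.
by elim: r => [|i r IH]; rewrite ?big_nil // big_cons trop_add_le IH.
Qed.

Lemma trop_le_sum (I : finType) (F : I -> T) i : F i <= \sum_i F i.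
Proof. by move: i; apply/trop_sum_le. Qed.

(** A finite tropical sum is a maximum, so it is attained. *)
Lemma trop_sum_attained (I : finType) (F : I -> T) :
  \sum_i F i != 0 -> exists i, \sum_i F i = F i.
Proof.
suff : \sum_i F i = 0 \/ exists i, \sum_i F i = F i by case=> [->|//]; rewrite eqxx.
elim: (index_enum I) => [|i r IH]; first by left; rewrite big_nil.
rewrite big_cons; case: IH => [->|[k ->]]; first by right; exists i; rewrite addr0.
right; case Fi: (F i) => [a|]; case Fk: (F k) => [b|].
- case: (leP a b) => ab.
    by exists k; rewrite Fk; congr Some; apply/max_idPr.
  by exists i; rewrite Fi; congr Some; apply/max_idPl/ltW.
- by exists i; rewrite Fi.
- by exists k; rewrite Fk.
by exists k; rewrite Fk.
Qed.

Lemma trop_ler_wM2l x y z : y <= z -> x * y <= x * z.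
Proof. by case: x y z => [a|] [b|] [c|] //=; rewrite !trop_mulE !trop_leE lerD2l. Qed.

Lemma trop_mul_eq0 x y : (x * y == 0) = (x == 0) || (y == 0).
Proof. by case: x y => [a|] [b|]. Qed.

Lemma trop_mul_neq0 x y : x * y != 0 -> x != 0 /\ y != 0.
Proof. by rewrite trop_mul_eq0 negb_or => /andP. Qed.

Lemma trop_mulSK (a : R) x y : a%:T * x = y -> x = (- a)%:T * y.
Proof. by move=> <-; case: x => //= b; rewrite !trop_mulE addKr. Qed.

Lemma trop_mulI (a : R) : injective (fun x : T => x * a%:T).
Proof. by case=> [x|] [y|] //= [/addIr->]. Qed.

End TropicalOrder.

(** * Irredundant matrices *)

(** Entries are indexed by arbitrary finite types, so that a matrix can be cut
    into blocks and reassembled without arithmetic on sizes. *)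
Definition transpose (I J : Type) (X : Type) (B : I -> J -> X) j i := B i j.

Section Irredundant.
Variable R : realType.
Local Open Scope ring_scope.
Local Notation T := (tropical R).

(** In some column [j] row [i] is finite and cannot be reached from the other
    rows: the multiple of row [k] which agrees with row [i] in column [j]
    exceeds row [i] in a column [l].  This is the statement that row [i] is not
    a tropical combination of the other rows. *)
Definition irredundant (I J : finType) (B : I -> J -> T) : Prop :=
  forall i, exists j, B i j != 0 /\
    forall k, k != i -> exists l, B i l * B k j < B k l * B i j.

Lemma irredundant_inj (I J : finType) (B : I -> J -> T) (i k : I) (c : R) :
  irredundant B -> (forall l, B k l = c%:T * B i l) -> k = i.
Proof.
move=> irrB Bk; apply/eqP; apply: contraT => ki.
have [j [_ /(_ _ ki)[l]]] := irrB i.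
by rewrite !Bk mulrCA mulrA ltxx.
Qed.

(** Two families of vectors which span the same space, one of them irredundant,
    agree up to a permutation and scaling: substituting one family of
    combinations in the other expresses each row [B i] through all the rows of
    [B], and in its special column only [B i] itself can account for its value. *)
Lemma irredundant_basis_unique (I J : finType) (B C : I -> J -> T)
    (X Y : I -> I -> T) :
  irredundant B ->
  (forall i j, C i j = \sum_k X i k * B k j) ->
  (forall i j, B i j = \sum_k Y i k * C k j) ->
  exists (s : I -> I) (d : I -> R),
    injective s /\ forall i j, C i j = (d i)%:T * B (s i) j.
Proof.
move=> irrB CX BY.
have leC k k' l : X k k' * B k' l <= C k l.
  by rewrite CX; apply: (trop_le_sum (fun k' => X k k' * B k' l)).
have leB i k l : Y i k * C k l <= B i l.
  by rewrite BY; apply: (trop_le_sum (fun k => Y i k * C k l)).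
have key i : exists k (d : R), forall l, C k l = d%:T * B i l.
  have [j [Bij irr]] := irrB i.
  have /trop_sum_attained[k Ek] : \sum_k Y i k * C k j != 0 by rewrite -BY.
  rewrite -BY in Ek.
  have Ckj : C k j != 0.
    by apply: contraNneq Bij => C0; rewrite Ek C0 mulr0.
  have /trop_sum_attained[k' Ek'] : \sum_k' X k k' * B k' j != 0 by rewrite -CX.
  rewrite -CX in Ek'.
  have [k'i|k'i] := eqVneq k' i; last first.
    have [l] := irr _ k'i; rewrite Ek Ek' ltNge => /negP[].
    rewrite (_ : B k' l * _ = B k' j * (Y i k * (X k k' * B k' l))); last first.
      by rewrite mulrCA (mulrCA (B k' l)) [RHS]mulrCA (mulrCA (B k' j)) (mulrC (B k' l)).
    rewrite [leRHS]mulrC; apply: trop_ler_wM2l.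
    by apply: le_trans (leB i k l); apply: trop_ler_wM2l.
  rewrite {}k'i in Ek'; move: Ek; rewrite Ek' => Ek.
  have [x Xx] : exists x, X k i = Some x.
    by apply: trop_neq0; move: Ckj; rewrite Ek' => /trop_mul_neq0[].
  have [y Yy] : exists y, Y i k = Some y.
    by apply: trop_neq0; move: Bij; rewrite Ek => /trop_mul_neq0[].
  have yx : y = - x.
    have [b Bb] := trop_neq0 Bij.
    move: Ek; rewrite Bb Xx Yy !trop_mulE => -[].
    by move=> E; apply/eqP; rewrite -addr_eq0; apply/eqP; lra.
  exists k, x => l; apply/eqP; rewrite eq_le; apply/andP; split.
    have := trop_ler_wM2l x%:T (leB i k l); rewrite Yy yx mulrA trop_mulE.
    by rewrite subrr mul1r.
  by have := leC k i l; rewrite Xx.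
have [f fP] := choice key.
have [d dP] := choice fP.
have finj : injective f.
  move=> i i' ii'; have E l : B i l = (d i' - d i)%:T * B i' l.
    apply: (@trop_mulI _ (d i)); rewrite mulrC -dP ii' dP.
    by case: (B i' l) => //= b; rewrite !trop_mulE; congr Some; lra.
  exact: irredundant_inj E.
exists (invF finj), (d \o invF finj); split.
  by move=> i k /(congr1 f); rewrite !f_invF.
by move=> i j /=; rewrite -dP f_invF.
Qed.

End Irredundant.

(** * Monomial maps between matrices *)

Definition monomial (R : Type) (I I' : Type) := I -> I' * R.

Section Monomial.
Variable R : realType.
Local Open Scope ring_scope.
Local Notation T := (tropical R).

Definition mon_id (I : Type) : monomial R I I := fun i => (i, 0).

Definition mon_comp (I1 I2 I3 : Type) (u : monomial R I1 I2) (v : monomial R I2 I3) :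
  monomial R I1 I3 :=
  fun i => ((v (u i).1).1, (u i).2 + (v (u i).1).2).

Lemma mon_compA (I1 I2 I3 I4 : Type) (u : monomial R I1 I2) (v : monomial R I2 I3)
    (w : monomial R I3 I4) :
  mon_comp u (mon_comp v w) = mon_comp (mon_comp u v) w.
Proof. by apply/funext => i; rewrite /mon_comp /= addrA. Qed.

Lemma mon_comp1 (I1 I2 : Type) (u : monomial R I1 I2) : mon_comp u (@mon_id _) = u.
Proof. by apply/funext => i; rewrite /mon_comp /= addr0; case: (u i). Qed.

Lemma mon_1comp (I1 I2 : Type) (u : monomial R I1 I2) : mon_comp (@mon_id _) u = u.
Proof. by apply/funext => i; rewrite /mon_comp /= add0r; case: (u i). Qed.

(** Only the action on rows is recorded: for irredundant matrices the
    permutation and scaling of the columns is determined by it. *)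
Definition mon_iso (I J I' J' : finType) (B : I -> J -> T) (B' : I' -> J' -> T)
    (u : monomial R I I') : Prop :=
  bijective (fun i => (u i).1) /\
  exists (g : J -> J') (e : J -> R), bijective g /\
    forall i j, (u i).2%:T * B' (u i).1 (g j) = B i j * (e j)%:T.

Definition mon_equiv (I J I' J' : finType) (B : I -> J -> T) (B' : I' -> J' -> T) :=
  exists u, mon_iso B B' u.

Lemma mon_iso_id (I J : finType) (B : I -> J -> T) : mon_iso B B (@mon_id I).
Proof.
split; first by exists id.
by exists id, (fun=> 0); split=> [|i j]; [exists id | rewrite mulrC].
Qed.

Lemma mon_iso_comp (I J I' J' I2 J2 : finType) (B : I -> J -> T)
    (B' : I' -> J' -> T) (B2 : I2 -> J2 -> T) u v :
  mon_iso B B' u -> mon_iso B' B2 v -> mon_iso B B2 (mon_comp u v).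
Proof.
move=> [ubij [g [e [gbij ue]]]] [vbij [g2 [e2 [g2bij ve]]]].
split; first exact: bij_comp vbij ubij.
exists (g2 \o g), (fun j => e j + e2 (g j)); split; first exact: bij_comp.
move=> i j /=.
by rewrite -!trop_mulE -mulrA ve mulrA ue mulrA.
Qed.

Lemma mon_iso_inv (I J I' J' : finType) (B : I -> J -> T) (B' : I' -> J' -> T) u :
  mon_iso B B' u ->
  exists v, [/\ mon_iso B' B v, mon_comp u v = @mon_id I & mon_comp v u = @mon_id I'].
Proof.
move=> [[f' uK f'K] [g [e [[g' gK g'K] ue]]]].
exists (fun i => (f' i, - (u (f' i)).2)); split.
- split; first by exists (fun i => (u i).1).
  exists g', (fun j => - e (g' j)); split; first by exists g.
  move=> i j /=; have := ue (f' i) (g' j); rewrite f'K g'K.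
  move/trop_mulSK->; rewrite -mulrA -[_ * (- _)%:T]mulrA trop_mulE subrr.
  by rewrite (_ : 0%:T = 1) // mulr1.
- by apply/funext => i; rewrite /mon_comp /= uK subrr.
by apply/funext => i; rewrite /mon_comp /= f'K addNr.
Qed.

Lemma mon_equiv_refl (I J : finType) (B : I -> J -> T) : mon_equiv B B.
Proof. by exists (@mon_id I); apply: mon_iso_id. Qed.

Lemma mon_equiv_trans (I J I' J' I2 J2 : finType) (B : I -> J -> T)
    (B' : I' -> J' -> T) (B2 : I2 -> J2 -> T) :
  mon_equiv B B' -> mon_equiv B' B2 -> mon_equiv B B2.
Proof. by move=> [u uP] [v vP]; exists (mon_comp u v); apply: mon_iso_comp vP. Qed.

Lemma mon_equiv_sym (I J I' J' : finType) (B : I -> J -> T) (B' : I' -> J' -> T) :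
  mon_equiv B B' -> mon_equiv B' B.
Proof. by move=> [u /mon_iso_inv[v [vP _ _]]]; exists v. Qed.

(** The monomial automorphisms of [B] form a group; [K] is that group up to
    isomorphism.  Phrasing this through an embedding of [K] avoids building the
    group of monomial maps. *)
Definition is_aut_group (K : groupType) (I J : finType) (B : I -> J -> T) : Prop :=
  exists chi : K -> monomial R I I,
    [/\ injective chi,
        forall x y, chi (x * y)%g = mon_comp (chi x) (chi y) &
        forall u, mon_iso B B u <-> exists x, u = chi x].

Lemma is_aut_group_equiv (K : groupType) (I J I' J' : finType)
    (B : I -> J -> T) (B' : I' -> J' -> T) :
  mon_equiv B B' -> is_aut_group K B' -> is_aut_group K B.
Proof.
move=> [u uP] [chi [chiI chiM chiE]]; have [v [vP uv vu]] := mon_iso_inv uP.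
have conjK w : mon_comp v (mon_comp (mon_comp u (mon_comp w v)) u) = w.
  by rewrite -!mon_compA vu mon_comp1 mon_compA vu mon_1comp.
exists (fun x => mon_comp u (mon_comp (chi x) v)); split.
- move=> x y /(congr1 (fun w => mon_comp v (mon_comp w u))).
  by rewrite !conjK => /chiI.
- move=> x y; rewrite chiM -!mon_compA; congr mon_comp; congr mon_comp.
  by rewrite (mon_compA v) vu mon_1comp.
move=> w; split=> [wP|[x ->]]; last first.
  apply: mon_iso_comp uP _; apply: mon_iso_comp vP; apply/chiE; by exists x.
have /chiE[x xE] := mon_iso_comp vP (mon_iso_comp wP uP).
exists x; rewrite -xE -!mon_compA uv mon_comp1.
by rewrite mon_compA uv mon_1comp.
Qed.

Lemma is_aut_group_isomorphic (K K' : groupType) (I J : finType) (B : I -> J -> T) :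
  is_aut_group K B -> is_aut_group K' B -> isomorphic K K'.
Proof.
move=> [chi [chiI chiM chiE]] [chi' [chi'I chi'M chi'E]].
have fP x : exists y, chi x = chi' y by apply/chi'E/chiE; exists x.
have gP y : exists x, chi' y = chi x by apply/chiE/chi'E; exists y.
have [f fE] := choice fP; have [g gE] := choice gP.
have fM : {morph f : x y / (x * y)%g}.
  by move=> x y; apply: chi'I; rewrite chi'M -!fE chiM.
pose F := @Multiplicative.Pack K K' f
  (@Multiplicative.Class K K' f (isMultiplicative.Build K K' f fM)).
exists F; exists g => x /=.
  by apply: chiI; rewrite -gE -fE.
by apply: chi'I; rewrite -fE -gE.
Qed.

Lemma is_aut_group_transfer (K K' : groupType) (I J : finType) (B : I -> J -> T) :
  is_aut_group K B -> isomorphic K K' -> is_aut_group K' B.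
Proof.
move=> [chi [chiI chiM chiE]] [f [g fK gK]].
exists (chi \o g); split.
- by move=> x y /= /chiI /(can_inj gK).
- by move=> x y /=; rewrite -chiM; congr chi; apply: (can_inj fK); rewrite gmulfM /= !gK.
move=> u; rewrite chiE; split=> -[x ->]; first by exists (f x); rewrite /= fK.
by exists (g x).
Qed.

End Monomial.

(** * Schutzenberger groups and reduced matrices *)

Section Schutzenberger.
Variable R : realType.
Local Open Scope ring_scope.
Local Notation T := (tropical R).

(** Row [i] of a product [mon_mx u *m X] is row [(u i).1] of [X], scaled by
    [(u i).2]; with this convention [mon_mx] is multiplicative for [mon_comp]. *)
Definition mon_mx (p : nat) (u : monomial R 'I_p 'I_p) : 'M[T]_p :=
  \matrix_(i, k) if k == (u i).1 then (u i).2%:T else 0.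

Lemma mul_mon_mxE (p k : nat) (u : monomial R 'I_p 'I_p) (X : 'M[T]_(p, k)) i j :
  (mon_mx u *m X) i j = (u i).2%:T * X (u i).1 j.
Proof.
rewrite mxE (bigD1 (u i).1) //= big1 ?addr0 ?mxE ?eqxx // => l lu.
by rewrite mxE (negPf lu) mul0r.
Qed.

Lemma mon_mxM (p : nat) (u v : monomial R 'I_p 'I_p) :
  mon_mx u *m mon_mx v = mon_mx (mon_comp u v).
Proof.
apply/matrixP => i j; rewrite mul_mon_mxE !mxE /=.
by case: ifP => _; rewrite ?trop_mulE // mulr0.
Qed.

Lemma mon_mx1 (p : nat) : mon_mx (@mon_id R 'I_p) = 1%:M.
Proof. by apply/matrixP => i j; rewrite !mxE /= eq_sym; case: eqP. Qed.

Lemma mon_mx_inv (p : nat) (g : 'I_p -> 'I_p) (e : 'I_p -> R) :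
  bijective g -> exists N, mon_mx (fun j => (g j, e j)) *m N = 1%:M.
Proof.
move=> [g' gK _]; exists (mon_mx (fun j => (g' j, - e (g' j)))).
rewrite mon_mxM -mon_mx1; congr mon_mx; apply/funext => j.
by rewrite /mon_comp /= gK subrr.
Qed.

(** [B] is a reduction of [A]: its rows and columns are combinations of those of
    [A] and suffice to recover [A] up to the given changes of generators. *)
Section Reduction.
Variables (n m p k : nat) (n_gt0 : (0 < n)%N) (m_gt0 : (0 < m)%N).
Variables (A : 'M[T]_(n, m)) (P : 'M[T]_(p, n)) (Q : 'M[T]_(m, k)).
Variables (U : 'M[T]_(n, p)) (V : 'M[T]_(k, m)).
Hypotheses (UPA : U *m P *m A = A) (AQV : A *m Q *m V = A).
Variable B : 'M[T]_(p, k).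
Hypothesis BE : P *m A *m Q = B.
Hypotheses (irrB : irredundant B) (irrBt : irredundant (transpose B)).

Let BV : B *m V = P *m A. Proof. by rewrite -BE -!mulmxA (mulmxA A) AQV. Qed.
Let UB : U *m B = A *m Q. Proof. by rewrite -BE !mulmxA UPA. Qed.

Lemma Hclass_mul C : Hclass A C <->
  [/\ exists X, A = C *m X, exists X, C = A *m X,
      exists X, A = X *m C & exists X, C = X *m A].
Proof.
rewrite /Hclass /= /greenH greenR_mul // greenL_mul //.
by split=> [[[? ?] [? ?]]|[? ? ? ?]].
Qed.

Lemma mon_mx_inj u u' :
  mon_mx u *m (P *m A) = mon_mx u' *m (P *m A) -> u = u'.
Proof.
move=> /(congr1 (mulmx^~ Q)); rewrite -!mulmxA (mulmxA P) BE => E.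
apply/funext => i.
have Ei j : (u i).2%:T * B (u i).1 j = (u' i).2%:T * B (u' i).1 j.
  by rewrite -!mul_mon_mxE E.
have ii' : (u' i).1 = (u i).1.
  apply: (@irredundant_inj _ _ _ _ _ _ (- (u' i).2 + (u i).2) irrB) => j.
  by rewrite -trop_mulE -mulrA Ei mulrA trop_mulE addNr mul1r.
have [j [nz _]] := irrB (u i).1.
move: (Ei j); rewrite ii'; have [b ->] := trop_neq0 nz.
rewrite !trop_mulE => -[] /addIr E2.
by rewrite (surjective_pairing (u i)) (surjective_pairing (u' i)) ii' E2.
Qed.

(** Left and right multiplication by the factors which relate [C] to [A] are
    automorphisms of the row space and of the column space; both permute the
    extremal rays. *)
Lemma Hclass_mon C : Hclass A C ->
  exists u, mon_iso B B u /\ P *m C = mon_mx u *m (P *m A).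
Proof.
move=> /Hclass_mul[[Y' AY'] [Y CY] [X' AX'] [X CX]].
have UPC : U *m P *m C = C by rewrite CY mulmxA UPA.
have CQV : C *m Q *m V = C by rewrite CX -!mulmxA (mulmxA A) AQV.
pose C0 := P *m C *m Q.
have C0X : C0 = P *m X *m U *m B.
  by rewrite -mulmxA UB /C0 CX !mulmxA.
have BX : B = P *m X' *m U *m C0.
  by rewrite /C0 -!mulmxA (mulmxA P C) (mulmxA U) (mulmxA U P) UPC -BE AX' !mulmxA.
have C0Y : C0 = B *m (V *m Y *m Q).
  by rewrite !mulmxA BV /C0 CY !mulmxA.
have BY : B = C0 *m (V *m Y' *m Q).
  by rewrite /C0 !mulmxA -(mulmxA P C) -(mulmxA P _ V) CQV -BE AY' !mulmxA.
have [s [d [sI sE]]] : exists s d, injective s /\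
    forall i j, C0 i j = (d i)%:T * B (s i) j.
  apply: (@irredundant_basis_unique R 'I_p 'I_k B C0 (P *m X *m U) (P *m X' *m U)) => //.
    by move=> i j; rewrite {1}C0X mxE.
  by move=> i j; rewrite {1}BX mxE.
have [t [e [tI tE]]] : exists t e, injective t /\
    forall j i, transpose C0 j i = (e j)%:T * transpose B (t j) i.
  apply: (@irredundant_basis_unique R 'I_k 'I_p (transpose B) (transpose C0)
    (transpose (V *m Y *m Q)) (transpose (V *m Y' *m Q))) => //.
    by move=> i j; rewrite /transpose {1}C0Y mxE; apply: eq_bigr => l _; rewrite mulrC.
  by move=> i j; rewrite /transpose {1}BY mxE; apply: eq_bigr => l _; rewrite mulrC.
exists (fun i => (s i, d i)); split.
  split; first exact: injF_bij.
  have [t' tK t'K] := injF_bij tI.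
  exists t', (e \o t'); split; first by exists t.
  by move=> i j /=; rewrite -sE; have := tE (t' j) i; rewrite /transpose t'K mulrC.
rewrite -BV -[in LHS]CQV !mulmxA; congr (_ *m V).
rewrite -/C0.
by apply/matrixP => i j; rewrite [RHS]mul_mon_mxE -sE.
Qed.

(** A monomial automorphism of [B] extends to the row and column spaces of [A]
    by way of the change of generators [U]; it maps [A] into its H-class because
    the inverse automorphism extends in the same way. *)
Lemma mon_iso_translation u : mon_iso B B u ->
  exists2 s : 'M[T]_n, ([set s *m C | C in Hclass A] `<=` Hclass A)%classic &
    P *m (s *m A) = mon_mx u *m (P *m A).
Proof.
move=> uP; have [v [vP uv vu]] := mon_iso_inv uP.
case: (uP) => [_ [g [e [gbij gE]]]]; have [N' NN'] := mon_mx_inv e gbij.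
set N := mon_mx _ in NN'; set M := mon_mx u; set M' := mon_mx v.
have M'M : M' *m M = 1%:M by rewrite mon_mxM vu mon_mx1.
(* The same automorphism, read on the columns. *)
have MB : M *m B = B *m N.
  apply/matrixP => i j; rewrite mul_mon_mxE [RHS]mxE; have [g' gK g'K] := gbij.
  rewrite -[j in LHS]g'K gE (bigD1 (g' j)) //= big1 ?addr0; last first.
    move=> l lj; rewrite [N _ _]mxE /=; case: eqP => [jl|_]; last by rewrite mulr0.
    by rewrite jl gK eqxx in lj.
  by rewrite [N _ _]mxE g'K /= eqxx.
have UBV : U *m B *m V = A by rewrite UB.
pose s := U *m M *m P; pose t := U *m M' *m P.
have sA : s *m A = A *m (Q *m N *m V).
  by rewrite /s -!mulmxA -BV (mulmxA M) MB -mulmxA !mulmxA UB.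
have PsA : P *m (s *m A) = M *m (P *m A).
  by rewrite sA !mulmxA BE -MB -mulmxA BV !mulmxA.
have tsA : t *m (s *m A) = A.
  by rewrite /t -mulmxA PsA (mulmxA (U *m M')) -(mulmxA U) M'M mulmx1 mulmxA UPA.
have sAA : s *m A *m (Q *m N' *m V) = A.
  have AQN : A *m Q *m N = U *m M *m B by rewrite -UB -!mulmxA MB.
  have BVQ : B *m V *m Q = B by rewrite BV.
  rewrite sA !mulmxA AQN -(mulmxA (U *m M) B) -(mulmxA (U *m M) _ Q) BVQ.
  by rewrite -(mulmxA U M) MB !mulmxA -(mulmxA (U *m B)) NN' mulmx1 UBV.
exists s => // _ [C /Hclass_mul[[Y' AY'] [Y CY] [X' AX'] [X CX]] <-].
apply/Hclass_mul; split.
- by exists (Y' *m (Q *m N' *m V)); rewrite mulmxA -(mulmxA s) -AY'.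
- by exists (Q *m N *m V *m Y); rewrite mulmxA -sA CY mulmxA.
- exists (X' *m t); rewrite -mulmxA.
  by rewrite CY (mulmxA s) (mulmxA t) tsA -CY.
by exists (s *m X); rewrite CX mulmxA.
Qed.

(** Every member of the H-class is [A] times something on the right, so that a
    translation is determined by its value at [A], which in turn is given by a
    monomial automorphism of [B]. *)
Theorem schutzenberger_aut_group : is_aut_group (schutzenberger A) B.
Proof.
pose A0 : Hclass A := SigSub (mem_set (Hclass_refl A)).
pose ev (f : schutzenberger A) : 'M[T]_(n, m) := \val (\val f A0).
have evE (f : schutzenberger A) (x : Hclass A) X : \val x = A *m X ->
    \val (\val f x) = ev f *m X.
  move=> xE; have [s _ sE] := set_mem (valP f).
  by rewrite /ev !sE xE mulmxA.
have HevP f : Hclass A (ev f) by apply: set_mem (valP (\val f A0)).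
have [chi chiP] := choice (fun f => Hclass_mon (HevP f)).
exists chi; split.
- move=> f g fg; have evfg : ev f = ev g.
    have E : P *m ev f = P *m ev g by rewrite (chiP f).2 (chiP g).2 fg.
    have [_ [Xf fX] _ _] := (Hclass_mul _).1 (HevP f).
    have [_ [Xg gX] _ _] := (Hclass_mul _).1 (HevP g).
    by rewrite fX gX -UPA -!mulmxA -fX -gX E.
  apply: val_inj; apply/funext => x; apply: val_inj.
  have [_ [X xX] _ _] := (Hclass_mul _).1 (set_mem (valP x)).
  by rewrite !(evE _ _ _ xX) evfg.
- move=> f g; apply: mon_mx_inj; rewrite -(chiP _).2 -mon_mxM.
  have [_ [Y gY] _ _] := (Hclass_mul _).1 (HevP g).
  rewrite (_ : ev (f * g)%g = ev f *m Y); last exact: (evE f (\val g A0) Y gY).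
  by rewrite mulmxA (chiP f).2 -!mulmxA -gY (chiP g).2.
move=> u; split=> [uP|[f ->]]; last exact: (chiP f).1.
have [s sH sE] := mon_iso_translation uP.
have fH (x : Hclass A) : Hclass A (s *m \val x).
  by apply: sH; exists (\val x) => //; apply: set_mem (valP x).
pose f0 (x : Hclass A) : Hclass A := SigSub (mem_set (fH x)).
have f0P : translations f0 by exists s.
exists (SigSub (mem_set f0P) : schutzenberger A).
by apply: mon_mx_inj; rewrite -sE -(chiP _).2.
Qed.

End Reduction.

End Schutzenberger.

(** * Every matrix has a reduction *)

Section Reduce.
Variable R : realType.
Local Open Scope ring_scope.
Local Notation T := (tropical R).

Definition trop_inv (x : T) : T := if x is Some a then (- a)%:T else 0.

(** Row [i] of [U] holds the coefficients which restore the deleted row. *)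
Lemma drop_row (p k : nat) (B : 'M[T]_(p.+1, k)) i (c : 'I_p -> T) :
  (forall l, B i l = \sum_r c r * B (lift i r) l) ->
  exists (P : 'M[T]_(p, p.+1)) (U : 'M[T]_(p.+1, p)), U *m P *m B = B.
Proof.
move=> Bi; pose P : 'M[T]_(p, p.+1) := \matrix_(r, s) (s == lift i r)%:R.
pose U : 'M[T]_(p.+1, p) :=
  \matrix_(s, r) if unlift i s is Some s' then (s' == r)%:R else c r.
have PB r l : (P *m B) r l = B (lift i r) l.
  rewrite mxE (bigD1 (lift i r)) //= big1 ?addr0 ?mxE ?eqxx ?mul1r // => s sr.
  by rewrite mxE (negPf sr) mul0r.
exists P, U; rewrite -mulmxA; apply/matrixP => s l.
case: (unliftP i s) => [s' ->|->]; rewrite mxE.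
  rewrite (bigD1 s') //= big1 ?addr0 ?PB ?mxE ?liftK ?eqxx ?mul1r // => r rs.
  by rewrite mxE liftK eq_sym (negPf rs) mul0r.
by rewrite Bi; apply: eq_bigr => r _; rewrite PB mxE unlift_none.
Qed.

(** A row which is reached in every column from another row is the combination
    of these other rows, each scaled to touch it from below. *)
Lemma redundant_row (p k : nat) (B : 'M[T]_(p.+1, k)) : ~ irredundant B ->
  exists (P : 'M[T]_(p, p.+1)) (U : 'M[T]_(p.+1, p)), U *m P *m B = B.
Proof.
move=> redB.
(* A zero row is redundant without being touched by another row. *)
have [[i Bi0]|nz] := pselect (exists i, forall l, B i l = 0).
  by apply: (@drop_row _ _ _ i (fun=> 0)) => l; rewrite Bi0 big1 // => r _; rewrite mul0r.
have /existsNP[i /forallNP Hi] := redB.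
(* The multiple of row [lift i r] that agrees with row [i] in column [j] lies
   below row [i]. *)
pose touch r j := `[< B i j != 0 /\
  forall l, B (lift i r) l * B i j <= B i l * B (lift i r) j >].
pose c r := \sum_j if touch r j then trop_inv (B (lift i r) j) * B i j else 0.
apply: (@drop_row _ _ _ i c) => l; apply/eqP; rewrite eq_le; apply/andP; split; last first.
  apply/trop_sum_le => r; rewrite /c mulr_suml; apply/trop_sum_le => j.
  case: ifPn => [/asboolP[_ /(_ l)]|_]; last by rewrite mul0r trop_le0x.
  case: (B (lift i r) j) => [b|] /=; last by rewrite !mul0r trop_le0x.
  move=> /(trop_ler_wM2l (- b)%:T).
  by rewrite -mulrA [_ * B (lift i r) l]mulrC => /le_trans; apply;
    rewrite [_ * b%:T]mulrC mulrA trop_mulE addNr mul1r.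
have [->|Bil] := eqVneq (B i l) 0; first exact: trop_le0x.
have [r [touchr Brl]] : exists r, touch r l /\ B (lift i r) l != 0.
  have /not_andP[//|/existsNP[s /not_implyP[si /forallNP Hs]]] := Hi l.
  move: si Hs; case: (unliftP i s) => [r ->|->]; last by rewrite eqxx.
  move=> _ Hs; exists r.
  have Hr l' : B (lift i r) l' * B i l <= B i l' * B (lift i r) l.
    by rewrite leNgt; apply/negP/Hs.
  split; first by apply/asboolP.
  apply/eqP => Brl; apply: nz; exists (lift i r) => l'; apply/eqP.
  have := Hr l'; rewrite Brl mulr0 trop_lex0 trop_mul_eq0.
  by rewrite (negPf Bil) orbF.
apply: le_trans (trop_le_sum (fun r => c r * B (lift i r) l) r).
rewrite /c mulr_suml.
apply: le_trans (trop_le_sum (fun j => (if touch r j then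
  trop_inv (B (lift i r) j) * B i j else 0) * B (lift i r) l) l).
rewrite touchr; have [b ->] := trop_neq0 Brl.
by rewrite /= mulrAC trop_mulE addNr mul1r.
Qed.

(** A generating set of least size for the row space is irredundant, also after
    the columns are cut down to generators of the column space. *)
Lemma minimal_rows (n m : nat) (A : 'M[T]_(n, m)) :
  exists (p : nat) (P : 'M[T]_(p, n)) (U : 'M[T]_(n, p)),
    [/\ (p <= n)%N, U *m P *m A = A &
      forall (k : nat) (Q : 'M[T]_(m, k)) (V : 'M[T]_(k, m)),
        A *m Q *m V = A -> irredundant (P *m A *m Q)].
Proof.
pose gen p := `[< exists (P : 'M[T]_(p, n)) (U : 'M[T]_(n, p)), U *m P *m A = A >].
have gen_n : gen n by apply/asboolP; exists 1%:M, 1%:M; rewrite !mul1mx.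
case: (ex_minnP (ex_intro gen n gen_n)) => p /asboolP[P [U UPA]] pmin.
exists p, P, U; split=> //; first exact: pmin.
move=> k Q V AQV; case: p => [|p] in P U UPA pmin *; first by case.
apply: contrapT => /redundant_row[P1 [U1 E]].
have /pmin : gen p; last by rewrite ltnn.
apply/asboolP; exists (P1 *m P), (U *m U1).
have PAE : P *m A = P *m A *m Q *m V by rewrite -!mulmxA (mulmxA A) AQV.
rewrite -!mulmxA PAE (mulmxA P1) (mulmxA U1) (mulmxA U1 P1) E.
by rewrite -PAE mulmxA UPA.
Qed.

Lemma reduction_exists (n m : nat) (A : 'M[T]_(n, m)) :
  exists (p k : nat) (P : 'M[T]_(p, n)) (Q : 'M[T]_(m, k))
         (U : 'M[T]_(n, p)) (V : 'M[T]_(k, m)),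
    [/\ (p <= n)%N, (k <= m)%N, U *m P *m A = A, A *m Q *m V = A &
        irredundant (P *m A *m Q) /\ irredundant (transpose (P *m A *m Q))].
Proof.
have [p [P [U [pn UPA irrP]]]] := minimal_rows A.
have [k [Q [V [km VQA irrQ]]]] := minimal_rows A^T.
have AQV : A *m Q^T *m V^T = A.
  by apply: trmx_inj; rewrite !trmx_mul !trmxK mulmxA VQA.
exists p, k, P, Q^T, U, V^T; split=> //; split; first exact: irrP AQV.
have : irredundant (Q *m A^T *m P^T).
  by apply: (irrQ _ _ U^T); apply: trmx_inj; rewrite !trmx_mul !trmxK mulmxA UPA.
rewrite (_ : Q *m A^T *m P^T = (P *m A *m Q^T)^T); last first.
  by rewrite !trmx_mul trmxK mulmxA.
by congr irredundant; apply/funext => i; apply/funext => j; rewrite /transpose mxE.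
Qed.

End Reduce.

(** * Direct sums of connected blocks *)

Section Bijections.

Lemma inj_surj_bij (X Y : Type) (f : X -> Y) :
  injective f -> (forall y, exists x, f x = y) -> bijective f.
Proof.
move=> fI /choice[g gP]; exists g => // x.
by apply: fI; rewrite gP.
Qed.

Lemma surj_inj (X : finType) (f : X -> X) :
  (forall y, exists x, f x = y) -> injective f.
Proof.
move=> /choice[g gK]; have [g' gg' g'g] := injF_bij (can_inj gK).
by move=> x y fxy; rewrite -(g'g x) -(g'g y) -(gK (g' x)) -(gK (g' y)) !g'g fxy.
Qed.

(** Decidable equality makes proofs of [l = l] unique, so that no transport is
    left between the two components. *)
Lemma Tagged_inj (L : eqType) (X : L -> Type) l (x y : X l) :
  Tagged X x = Tagged X y -> x = y.
Proof.
move=> E; pose F (u : {l & X l}) (e : tag u = l) := etagged (T_ := X) e.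
have FE (u v : {l & X l}) (uv : u = v) eu ev : F u eu = F v ev.
  by case: _ / uv ev => ev; congr F; apply: eq_irrelevance.
by have := FE _ _ E erefl erefl.
Qed.

Lemma dep_choice (I : Type) (X : I -> Type) (P : forall i, X i -> Prop) :
  (forall i, exists x, P i x) -> exists f : forall i, X i, forall i, P i (f i).
Proof. by move=> H; exists (fun i => projT1 (cid (H i))) => i; apply: projT2. Qed.

End Bijections.

Section DirectSum.
Variable R : realType.
Local Open Scope ring_scope.
Local Notation T := (tropical R).

(** Connectedness of the bipartite graph of finite entries, as the absence of
    labellings of rows and columns which agree along the edges but are not
    constant. *)
Definition connected_block (I J : finType) (B : I -> J -> T) : Prop :=
  forall (X : Type) (f : I -> X) (g : J -> X),
    (forall i j, B i j != 0 -> f i = g j) -> forall i i', f i = f i'.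

(** Rows and columns are pairs of a block label and an index in the block; an
    entry is finite only if the labels agree. *)
Definition dsum (L : finType) (Om Ga : L -> finType)
    (B : forall l, Om l -> Ga l -> T) (p : {l & Om l}) (q : {l & Ga l}) : T :=
  untag 0 (B (tag p) (tagged p)) q.

Section GeneralSum.
Variables (L : finType) (Om Ga : L -> finType) (B : forall l, Om l -> Ga l -> T).
Hypothesis Om_gt0 : forall l, Om l.
Hypothesis conn : forall l, connected_block (B (l := l)).
Hypothesis row_neq0 : forall l (i : Om l), exists j, B i j != 0.
Hypothesis col_neq0 : forall l (j : Ga l), exists i, B i j != 0.

Local Notation tagO := (Tagged (fun l => Om l)).
Local Notation tagG := (Tagged (fun l => Ga l)).

Lemma dsum_same l (i : Om l) (j : Ga l) :
  dsum B (tagO i) (tagG j) = B i j.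
Proof. exact: (@untagE _ (fun l => Ga l) _ _ l (B i) (tagG j) erefl). Qed.

Lemma dsum_neq0 p q : dsum B p q != 0 -> tag p = tag q.
Proof.
rewrite /dsum => nz; apply/eqP; rewrite eq_sym.
by apply: contraNT nz => pq; rewrite untag_dflt.
Qed.

(** A monomial automorphism permutes the blocks, because each block is
    connected, and matches each block with its image. *)
Lemma mon_iso_dsum u : mon_iso (dsum B) (dsum B) u ->
  exists (pi : L -> L) (s : forall l, Om l -> Om (pi l)) (t : forall l, Ga l -> Ga (pi l))
         (d : forall l, Om l -> R) (e : forall l, Ga l -> R),
    [/\ injective pi, forall l, bijective (s l), forall l, bijective (t l),
        forall l (i : Om l), u (tagO i) =
          (tagO (s l i), d l i) &
        forall l i j, (d l i)%:T * B (s l i) (t l j) = B i j * (e l j)%:T].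
Proof.
move=> [ubij [g [e [gbij ue]]]].
have edge l (i : Om l) (j : Ga l) : B i j != 0 ->
    tag (u (tagO i)).1 = tag (g (tagG j)).
  move=> nz; apply: dsum_neq0.
  have := ue (tagO i) (tagG j).
  by rewrite dsum_same; apply: contra_eq_neq => ->; rewrite mulr0 eq_sym trop_mul_eq0 orbF.
pose pi l := tag (u (tagO (Om_gt0 l))).1.
have upi l (i : Om l) : tag (u (tagO i)).1 = pi l.
  exact: (conn (edge l)).
have gpi l (j : Ga l) : tag (g (tagG j)) = pi l.
  by have [i nz] := col_neq0 j; rewrite -(edge _ _ _ nz) upi.
have [u' uK u'K] := ubij; have [g' gK g'K] := gbij.
have upi' p : pi (tag p) = tag (u p).1 by case: p => l i /=; rewrite upi.
have gpi' p : pi (tag p) = tag (g p) by case: p => l i /=; rewrite gpi.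
have piI : injective pi.
  apply: surj_inj => l; exists (tag (u' (tagO (Om_gt0 l)))).
  by rewrite upi' u'K.
pose s l i := etagged (upi l i); pose t l j := etagged (gpi l j).
have sE l (i : Om l) : (u (tagO i)).1 = tagO (s l i).
  by rewrite /s etaggedK.
have tE l (j : Ga l) : g (tagG j) = tagG (t l j).
  by rewrite /t etaggedK.
exists pi, s, t, (fun l i => (u (tagO i)).2),
  (fun l j => e (tagG j)); split=> //.
- move=> l; apply: inj_surj_bij => [i i' ii'|i'].
    have : (u (tagO i)).1 = (u (tagO i')).1.
      by rewrite !sE ii'.
    by move=> /(can_inj uK) E; apply: (Tagged_inj E).
  case E : (u' (tagO i')) => [l' i].
  have Eu : (u (existT _ l' i)).1 = tagO i' by rewrite -E u'K.
  have ll : l' = l by apply: piI; rewrite -[pi l](congr1 tag Eu) -upi'.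
  subst l'; exists i; by have := sE l i; rewrite [LHS]Eu => E'; rewrite (Tagged_inj E').
- move=> l; apply: inj_surj_bij => [i i' ii'|i'].
    have : (g (tagG i)) = (g (tagG i')).
      by rewrite !tE ii'.
    by move=> /(can_inj gK) E; apply: (Tagged_inj E).
  case E : (g' (tagG i')) => [l' i].
  have Eu : (g (existT _ l' i)) = tagG i' by rewrite -E g'K.
  have ll : l' = l by apply: piI; rewrite -[pi l](congr1 tag Eu) -gpi'.
  subst l'; exists i; by have := tE l i; rewrite [LHS]Eu => E'; rewrite (Tagged_inj E').
- by move=> l i; rewrite -sE -surjective_pairing.
by move=> l i j; rewrite -dsum_same -[B i j]dsum_same -sE -tE ue.
Qed.

(** A row of another block vanishes in the special column of a row. *)
Lemma irredundant_dsum :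
  (forall l, irredundant (B (l := l))) -> irredundant (dsum B).
Proof.
move=> irrB [l i]; have [j [nz irr]] := irrB l i.
exists (tagG j); split; first by rewrite dsum_same.
move=> [l' k] ki; have [ll'|ll'] := eqVneq l' l; last first.
  have [j' nz'] := row_neq0 k.
  exists (tagG j').
  rewrite (_ : dsum B _ (tagG j) = 0); last first.
    by apply: contraNeq ll' => /dsum_neq0 /= ->.
  rewrite mulr0 trop_lt0x trop_mul_eq0 negb_or dsum_same nz' /=.
  by rewrite -[existT _ l i]/(tagO i) dsum_same.
subst l'; have [|j' lt] := irr k.
  by apply: contraNneq ki => ->.
exists (tagG j').
rewrite -[existT _ l i]/(tagO i).
by rewrite -[existT _ l k]/(tagO k) !dsum_same.
Qed.

End GeneralSum.

Lemma irredundant_row_neq0 (I J : finType) (B : I -> J -> T) :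
  irredundant B -> forall i, exists j, B i j != 0.
Proof. by move=> irrB i; have [j [nz _]] := irrB i; exists j. Qed.

Lemma transpose_dsum (L : finType) (Om Ga : L -> finType) (B : forall l, Om l -> Ga l -> T) :
  transpose (dsum B) = dsum (fun l => transpose (B l)).
Proof.
apply/funext => -[l j]; apply/funext => -[l' i]; rewrite /transpose.
have [ll'|ll'] := eqVneq l l'; last first.
  by rewrite /dsum /= !untag_dflt //= eq_sym.
by subst l'; rewrite (dsum_same B i j) (dsum_same (fun l => transpose (B l)) j i).
Qed.

(** [B] is normalised so that [G] acts by unscaled permutations, and [G] is the
    whole group of its automorphisms up to scaling. *)
Definition symmetry_group (G : finGroupType) (I J : finType)
    (to1 : {action G &-> I}) (to2 : {action G &-> J}) (B : I -> J -> T) : Prop :=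
  [/\ forall g i j, B (to1 i g) (to2 j g) = B i j,
      forall g, (forall i, to1 i g = i) -> g = 1%g &
      forall (s : I -> I) (t : J -> J) (d : I -> R) (e : J -> R),
        bijective s -> bijective t ->
        (forall i j, (d i)%:T * B (s i) (t j) = B i j * (e j)%:T) ->
        exists g, (forall i, s i = to1 i g) /\ (forall j, t j = to2 j g)].

Section WreathBlocks.
Variables (z : nat) (h : 'I_z -> nat) (G : 'I_z -> finGroupType).
Variables (Om Ga : 'I_z -> finType).
Variables (to1 : forall a, {action G a &-> Om a}) (to2 : forall a, {action G a &-> Ga a}).
Variable B : forall a, Om a -> Ga a -> T.
Hypothesis Om_gt0 : forall a, Om a.
Hypothesis conn : forall a, connected_block (B (a := a)).
Hypothesis col_neq0 : forall a (j : Ga a), exists i, B i j != 0.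
Hypothesis symB : forall a, symmetry_group (to1 a) (to2 a) (B (a := a)).
Hypothesis inequiv : forall a b, mon_equiv (B (a := a)) (B (a := b)) -> a = b.

Local Notation L := {a : 'I_z & 'I_(h a)}.
Local Notation K := (direct_prod_of
  (fun a => wreath (Algebra.to_multiplicative R * G a)%type (h a))).

Local Notation lbl a c := (Tagged (fun b : 'I_z => 'I_(h b)) (c : 'I_(h a))).
Local Notation OmL := (fun l : L => Om (tag l)).
Local Notation GaL := (fun l : L => Ga (tag l)).

Let BL : forall l : L, OmL l -> GaL l -> T := fun l => @B (tag l).

Let base (x : K) (l : L) := wreath_base (x (tag l)) (tagged l).
Let move (x : K) (l : L) : L := lbl (tag l) (wreath_perm (x (tag l)) (tagged l)).
Let chi (x : K) : monomial R {l : L & OmL l} {l : L & OmL l} := fun p =>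
  (@existT L OmL (move x (tag p)) (to1 (tag (tag p)) (tagged p) (base x (tag p)).2),
   (base x (tag p)).1).

Let chiM x y : chi (x * y)%g = mon_comp (chi x) (chi y).
Proof.
apply/funext => -[[a c] i]; rewrite /chi /mon_comp /move /base /= !ffunE !permM /=.
by rewrite actM.
Qed.

Let chiI : injective chi.
Proof.
move=> x y xy; apply: functional_extensionality_dep => a.
have [_ faith _] := symB a.
have E c (i : Om a) := congr1 (fun u => u (@existT L OmL (lbl a c) i)) xy.
have permE c : wreath_perm (x a) c = wreath_perm (y a) c.
  have := congr1 (fun u => tag u.1) (E c (Om_gt0 a)).
  by by rewrite /chi /move /= => E'; apply: (Tagged_inj E').
have baseE c : wreath_base (x a) c = wreath_base (y a) c.
  have r1 := congr1 snd (E c (Om_gt0 a)); rewrite /chi /base /= in r1.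
  have r2 : (wreath_base (x a) c).2 = (wreath_base (y a) c).2.
    apply/eqP; rewrite eq_mulVg1 eq_sym; apply/eqP/esym/faith => i; rewrite actM.
    have := congr1 fst (E c (to1 a i (wreath_base (x a) c).2^-1)%g).
    rewrite /chi /move /base /= permE => /(@Tagged_inj L OmL) <-.
    by rewrite -actM mulVg act1.
  by move: r1 r2; case: (wreath_base (x a) c) (wreath_base (y a) c) => [? ?] [? ?] /= -> ->.
case: (x a) (y a) permE baseE => [b1 p1] [b2 p2] /= pE bE; congr Wreath.
  exact/ffunP.
exact/permP.
Qed.

Let chi_mon_iso x : mon_iso (dsum BL) (dsum BL) (chi x).
Proof.
have moveI : injective (move x).
  move=> [a c] [a' c'] E; have aa' : a = a' := congr1 tag E; subst a'.
  by have /= /perm_inj -> := Tagged_inj E.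
split.
  apply: injF_bij => -[l i] [l' i'] /= E.
  have ll' : l = l' by apply: moveI; have := congr1 tag E.
  by subst l'; move/(@Tagged_inj L OmL): E => /act_inj ->.
exists (fun q => @existT L GaL (move x (tag q))
  (to2 (tag (tag q)) (tagged q) (base x (tag q)).2)), (fun q => (base x (tag q)).1).
split.
  apply: injF_bij => -[l i] [l' i'] /= E.
  have ll' : l = l' by apply: moveI; have := congr1 tag E.
  by subst l'; move/(@Tagged_inj L GaL): E => /act_inj ->.
move=> [l i] [l' j] /=; have [ll'|ll'] := eqVneq l l'.
  subst l'; rewrite mulrC; congr (_ * _).
  rewrite (@dsum_same _ OmL GaL BL l i j).
  rewrite (@dsum_same _ OmL GaL BL (move x l)).
  by have [invB _ _] := symB (tag l); apply: invB.
rewrite (_ : dsum _ (existT _ l i) _ = 0) ?mul0r; last first.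
  by apply: contraNeq ll' => /dsum_neq0 /= ->.
rewrite (_ : dsum _ _ _ = 0) ?mulr0 //.
by apply: contraNeq ll' => /dsum_neq0 /= /moveI ->.
Qed.

(** Inequivalence keeps the permutation of the blocks within each type [a], which
    makes it a family of permutations of the copies; on each copy the map is a
    symmetry in [G a] together with a scaling, which is constant because the
    block is connected. *)
Lemma wreath_aut_group : is_aut_group K (dsum BL).
Proof.
exists chi; split=> // u; split=> [uP|[x ->]]; last exact: chi_mon_iso.
have [pi [s [t [d [e [piI sbij tbij uE dE]]]]]] :=
  mon_iso_dsum (fun l => Om_gt0 (tag l)) (fun l => conn (a := tag l))
    (fun l => col_neq0 (a := tag l)) uP.
have tagpi l : tag (pi l) = tag l.
  symmetry; apply: inequiv; exists (fun i => (s l i, d l i)).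
  split; first exact: (sbij l).
  by exists (t l), (e l); split; [exact: tbij | exact: dE].
pose pc a (c : 'I_(h a)) : 'I_(h a) := etagged (tagpi (lbl a c)).
have pcE a c : pi (lbl a c) = lbl a (pc a c) by rewrite /pc etaggedK.
have pcI a : injective (pc a).
  by move=> c c' cc'; apply: (@Tagged_inj _ (fun a => 'I_(h a))); apply: piI; rewrite !pcE cc'.
have key l : exists b : Algebra.to_multiplicative R * G (tag l), forall i,
    (Tagged OmL (s l i), d l i) =
    (@existT L OmL (lbl (tag l) (pc (tag l) (tagged l))) (to1 (tag l) i b.2), b.1).
  case: l => a c; move: (sbij (lbl a c)) (tbij (lbl a c)) (dE (lbl a c)).
  move: (s (lbl a c)) (t (lbl a c)) (d (lbl a c)) (e (lbl a c)).
  rewrite /BL pcE /= => {uE sbij tbij dE}s0 t0 d0 e0 sb tb dE.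
  have [invB _ autB] := symB a.
  have [g [sg tg]] := autB s0 t0 d0 e0 sb tb dE.
  (* The symmetry itself fixes the entries, so the scalings cancel. *)
  have de i j : B i j != 0 -> d0 i = e0 j.
    move=> /trop_neq0[b Bij]; have := dE i j.
    by rewrite sg tg invB Bij !trop_mulE => -[]; rewrite addrC => /addrI.
  exists (d0 (Om_gt0 a), g) => i /=; rewrite sg; congr pair.
  exact: (conn de).
have [b bE] := dep_choice key.
pose x : K := fun a =>
  @Wreath (Algebra.to_multiplicative R * G a)%type (h a)
    [ffun c => (b (lbl a c) : (Algebra.to_multiplicative R * G a)%type)] (perm (@pcI a)).
exists x; apply/funext => -[[a c] i].
etransitivity; first exact: (uE (lbl a c) i).
rewrite bE /chi /move /base /=.
by rewrite ffunE permE.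
Qed.

End WreathBlocks.

End DirectSum.

(** * Splitting a matrix into connected blocks *)

Section Splitting.
Variable R : realType.
Local Open Scope ring_scope.
Local Notation T := (tropical R).

Lemma mon_equiv_transpose (I J I' J' : finType) (B : I -> J -> T) (B' : I' -> J' -> T) :
  mon_equiv B B' -> mon_equiv (transpose B) (transpose B').
Proof.
move=> [u [ubij [g [e [gbij ue]]]]].
exists (fun j => (g j, - e j)); split=> //.
exists (fun i => (u i).1), (fun i => - (u i).2); split=> // j i /=.
rewrite /transpose; have := ue i j; case: (B' _ _) (B i j) => [b'|] [b|] //=.
by rewrite !trop_mulE => -[E]; congr Some; lra.
Qed.

(** Irredundance compares products of two entries taken from the same two rows
    and the same two columns, where scalings cancel. *)
Lemma irredundant_equiv (I J I' J' : finType) (B : I -> J -> T) (B' : I' -> J' -> T) :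
  mon_equiv B B' -> irredundant B -> irredundant B'.
Proof.
move=> [u [[f' uK f'K] [g [e [[g' gK g'K] ue]]]]] irrB i.
have B'E i0 j : B' i0 (g j) = (- (u (f' i0)).2)%:T * (B (f' i0) j * (e j)%:T).
  by apply: trop_mulSK; rewrite -ue f'K.
have [j [nz irr]] := irrB (f' i).
exists (g j); split.
  by rewrite B'E !trop_mul_eq0 orbF.
move=> k ki; have [|l lt] := irr (f' k).
  by rewrite (inj_eq (can_inj f'K)).
exists (g l); rewrite !B'E.
move: (u _).2 (u _).2 => x y; move: (B _ l) (B _ j) (B _ j) (B _ l) lt.
case=> [b1|] [b2|] [b3|] [b4|] //=.
by rewrite !trop_mulE !trop_ltE; lra.
Qed.

Lemma connected_equiv (I J I' J' : finType) (B : I -> J -> T) (B' : I' -> J' -> T) :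
  mon_equiv B B' -> connected_block B -> connected_block B'.
Proof.
move=> [u [[f' uK f'K] [g [e [gbij ue]]]]] conn X f k fk i i'.
rewrite -(f'K i) -(f'K i').
apply: (conn X (fun i => f (u i).1) (fun j => k (g j))) => a b nz; apply: fk.
by apply: contraNneq nz => E; have := ue a b; rewrite E mulr0; case: (B a b).
Qed.

Lemma quotient_enum (X : finType) (E : X -> X -> Prop) :
  (forall x, E x x) -> (forall x y, E x y -> E y x) ->
  (forall x y z, E x y -> E y z -> E x z) ->
  exists (z : nat) (cls : X -> 'I_z) (rep : 'I_z -> X),
    (forall x y, E x y <-> cls x = cls y) /\ cancel rep cls.
Proof.
move=> refl sym trans.
pose S x : {set X} := [set y | `[< E x y >]].
have SE x y : E x y <-> S x = S y.
  split=> [xy|/setP/(_ y)]; last by rewrite !inE => e; apply/asboolP; rewrite e; apply/asboolP.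
  by apply/setP => w; rewrite !inE; apply/asboolP/asboolP; [move/sym in xy|]; apply: trans xy.
pose D := [set S x | x : X].
have SD x : S x \in D by apply: imset_f.
have repP (a : 'I_#|D|) : exists x, enum_val a = S x.
  by have /imsetP[x _ ->] := enum_valP a; exists x.
have [rep repE] := choice repP.
exists #|D|, (fun x => enum_rank_in (SD x) (S x)), rep; split=> [x y|a].
  rewrite SE; split=> [xy|/(congr1 enum_val)].
    apply: enum_val_inj; rewrite !enum_rankK_in //.
  by rewrite !enum_rankK_in.
by apply: enum_val_inj; rewrite enum_rankK_in // repE.
Qed.

Lemma fibre_enum (X : finType) (z : nat) (cls : X -> 'I_z) :
  exists x : {a : 'I_z & 'I_#|[pred y | cls y == a]|} -> X,
    bijective x /\ forall l, cls (x l) = tag l.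
Proof.
pose x (l : {a : 'I_z & 'I_#|[pred y | cls y == a]|}) : X := enum_val (tagged l).
have clsx l : cls (x l) = tag l by have := enum_valP (tagged l); rewrite inE => /eqP.
exists x; split=> //; apply: inj_surj_bij => [[a c] [a' c'] E|y].
  have aa' : a = a' by have := clsx (existT _ a c); rewrite E clsx.
  by subst a'; have /= -> := enum_val_inj E.
have yin : y \in [pred y' | cls y' == cls y] by rewrite inE.
by exists (Tagged (fun a => 'I_#|[pred y' | cls y' == a]|) (enum_rank_in yin y)); rewrite /x /= enum_rankK_in.
Qed.

Section Labels.
Variables (I J C : finType) (B : I -> J -> T) (cI : I -> C) (cJ : J -> C).
Hypothesis label : forall i j, B i j != 0 -> cI i = cJ j.

Definition subblock (x : C) (i : {i | cI i == x}) (j : {j | cJ j == x}) : T :=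
  B (val i) (val j).

(** The entries outside the diagonal blocks of the labelling vanish on both
    sides. *)
Lemma dsum_subblocks (L : finType) (x : L -> C) (Om Ga : L -> finType)
    (A : forall l, Om l -> Ga l -> T) :
  bijective x -> (forall l, mon_equiv (A l) (subblock (x := x l))) ->
  mon_equiv (dsum A) B.
Proof.
move=> xbij equiv; have [y xK yK] := xbij.
have [u uP] := dep_choice equiv.
have [g gP] := dep_choice (fun l => (uP l).2).
have [e eP] := dep_choice gP.
exists (fun p => (val (u (tag p) (tagged p)).1, (u (tag p) (tagged p)).2)); split.
  apply: inj_surj_bij => [[l i] [l' i']|i] /=.
    move=> E; have ll' : l = l'.
      apply: (bij_inj xbij).
      by rewrite -(eqP (valP (u l i).1)) -(eqP (valP (u l' i').1)) /= E.
    by subst l'; move/val_inj: E => /(bij_inj (uP l).1) ->.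
  have ci : cI i == x (y (cI i)) by rewrite yK.
  have [v _ vK] := (uP (y (cI i))).1.
  by exists (Tagged (fun l => Om l) (v (Sub i ci))); rewrite /= vK.
exists (fun p => val (g (tag p) (tagged p))), (fun p => e (tag p) (tagged p)); split.
  apply: inj_surj_bij => [[l i] [l' i']|i] /=.
    move=> E; have ll' : l = l'.
      apply: (bij_inj xbij).
      by rewrite -(eqP (valP (g l i))) -(eqP (valP (g l' i'))) /= E.
    by subst l'; move/val_inj: E => /(bij_inj (eP l).1) ->.
  have ci : cJ i == x (y (cJ i)) by rewrite yK.
  have [v _ vK] := (eP (y (cJ i))).1.
  by exists (Tagged (fun l => Ga l) (v (Sub i ci))); rewrite /= vK.
move=> [l i] [l' j] /=; have [ll'|ll'] := eqVneq l l'.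
  by subst l'; rewrite (dsum_same A i j) -(eP l).2.
rewrite (_ : dsum A _ _ = 0) ?mul0r; last first.
  by apply: contraNeq ll' => /dsum_neq0 /= ->.
rewrite (_ : B _ _ = 0) ?mulr0 //.
apply: contraNeq ll' => /label E; apply/eqP/(bij_inj xbij).
by rewrite -(eqP (valP (u l i).1)) -(eqP (valP (g l' j))) /= E.
Qed.

Lemma irredundant_subblock x : (forall i, exists j, B i j != 0) ->
  irredundant B -> irredundant (subblock (x := x)).
Proof.
move=> row irrB i; have [j [nz irr]] := irrB (val i).
have jx : cJ j == x by rewrite -(label nz) (valP i).
exists (Sub j jx); split=> // k ki.
have [|l lt] := irr (val k); first by rewrite val_eqE.
have lx : cJ l == x.
  have : B (val k) l != 0.
    by apply: contraTneq lt => ->; rewrite mul0r -leNgt trop_le0x.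
  by move=> /label <-; apply: (valP k).
by exists (Sub l lx).
Qed.

End Labels.

Section Components.
Variables (I J : finType) (B : I -> J -> T).
Hypotheses (irrB : irredundant B) (irrBt : irredundant (transpose B)).

Let adj : rel I := [rel i i' | [exists j, (B i j != 0) && (B i' j != 0)]].

Let adj_sym : connect_sym adj.
Proof.
apply: sym_connect_sym => i i' /=.
by apply/existsP/existsP => -[j]; rewrite andbC => nz; exists j.
Qed.

(** Rows are joined when they are finite in a common column; a column gets the
    component of any row in which it is finite. *)
Lemma component_labels : exists (C : finType) (cI : I -> C) (cJ : J -> C),
  [/\ forall i j, B i j != 0 -> cI i = cJ j,
      forall x, exists i, cI i = x &
      forall x, connected_block (@subblock _ _ _ B cI cJ x)].
Proof.
have [f fP] := choice (irredundant_row_neq0 irrBt).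
pose C : finType := {x : I | roots adj x}.
pose cI i : C := Sub (fingraph.root adj i) (fingraph.roots_root adj_sym i).
exists C, cI, (fun j => cI (f j)); split.
- move=> i j nz; apply: val_inj => /=; apply/(fingraph.rootP adj_sym)/connect1 => /=.
  by apply/existsP; exists j; rewrite nz fP.
- by move=> x; exists (val x); apply: val_inj; apply/eqP; apply: (valP x).
move=> x X g k gk i i'.
(* The labelling of one component is extended by [None], so that paths in the
   whole graph can be followed. *)
pose G0 i : option X := if insub i is Some i0 then Some (g i0) else None.
have GE (i0 : {i | cI i == x}) : G0 (val i0) = Some (g i0).
  by rewrite /G0 valK.
suff : G0 (val i) = G0 (val i') by rewrite !GE => -[].
have conn : connect adj (val i) (val i').
  apply/(fingraph.rootP adj_sym).
  exact: (congr1 val (etrans (eqP (valP i)) (esym (eqP (valP i'))))).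
pose a := [pred i0 | `[< G0 i0 = G0 (val i) >]].
have adjG i1 i2 : adj i1 i2 -> G0 i1 = G0 i2.
  move=> /= i12; have cc : cI i1 = cI i2.
    by apply: val_inj; apply/(fingraph.rootP adj_sym)/connect1.
  rewrite /G0; case: insubP => [u xu uE|nx]; case: insubP => [v xv vE|nx'] //.
  - have /existsP[j /andP[nz1 nz2]] := i12.
    have jx : cI (f j) == x.
      rewrite -(eqP xu); apply/eqP/val_inj/(fingraph.rootP adj_sym)/connect1.
      by apply/existsP; exists j; rewrite nz1 fP.
    congr Some; rewrite (gk u (Sub j jx)) ?(gk v (Sub j jx)) //.
      by rewrite /subblock /= vE.
    by rewrite /subblock /= uE.
  - by rewrite -cc xu in nx'.
  - by rewrite cc xv in nx.
have acl : closed adj a.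
  by move=> i1 i2 i12; rewrite !inE (adjG _ _ i12).
have := closed_connect acl conn; rewrite !inE asboolT // => /esym/asboolP.
by [].
Qed.

(** Equivalent components are copies of one block. *)
Theorem block_decomposition : exists (z : nat) (h : 'I_z -> nat)
    (Om Ga : 'I_z -> finType) (A : forall a, Om a -> Ga a -> T),
  [/\ forall a, (0 < h a)%N,
      mon_equiv (dsum (fun l : {a : 'I_z & 'I_(h a)} => A (tag l))) B,
      forall a b, mon_equiv (A a) (A b) -> a = b &
      forall a, [/\ (0 < #|Om a|)%N, connected_block (A a),
                    irredundant (A a) & irredundant (transpose (A a))]].
Proof.
have [C [cI [cJ [label surj conn]]]] := component_labels.
pose blk x := @subblock _ _ _ B cI cJ x.
have [z [cls [rep [clsE repK]]]] :=
  @quotient_enum C (fun x y => mon_equiv (blk x) (blk y))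
    (fun x => mon_equiv_refl _) (fun x y => @mon_equiv_sym _ _ _ _ _ _ _)
    (fun x y w => @mon_equiv_trans _ _ _ _ _ _ _ _ _ _).
have [x [xbij clsx]] := fibre_enum cls.
exists z, (fun a => #|[pred y | cls y == a]|), _, _, (fun a => blk (rep a)); split.
- by move=> a; apply/card_gt0P; exists (rep a); rewrite inE repK.
- by apply: (dsum_subblocks label xbij) => l; apply/clsE; rewrite repK clsx.
- by move=> a b /clsE; rewrite !repK.
move=> a; split=> //.
- by have [i ci] := surj (rep a); apply/card_gt0P; exists (Sub i (introT eqP ci)).
- exact: irredundant_subblock (irredundant_row_neq0 irrB) irrB.
apply: (@irredundant_subblock J I C (transpose B) cJ cI _ (rep a)) => //.
  by move=> j i /label.
exact: irredundant_row_neq0.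
Qed.

End Components.

End Splitting.

(** * The symmetry group of a connected block *)

Section Symmetrize.
Variable R : realType.
Local Open Scope ring_scope.
Local Notation T := (tropical R).

Definition trop_val (x : T) : R := if x is Some a then a else 0.

Lemma trop_valK (x : T) : x != 0 -> x = (trop_val x)%:T.
Proof. by case: x. Qed.

Section Group.
Variables (I J : finType) (B : I -> J -> T).
Hypotheses (irrB : irredundant B) (irrBt : irredundant (transpose B)).

(** The permutations of rows and columns that leave [B] fixed up to scalings. *)
Definition sym_set : {set {perm I} * {perm J}} :=
  [set p : {perm I} * {perm J} | `[< exists (d : I -> R) (e : J -> R),
     forall i j, (d i)%:T * B (p.1 i) (p.2 j) = B i j * (e j)%:T >] ].

Lemma sym_group_set : group_set sym_set.
Proof.
apply/group_setP; split.
  rewrite !inE; exists (fun=> 0), (fun=> 0) => i j.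
  by rewrite !perm1 mulrC.
move=> p q; rewrite !inE => -[d [e dE]] [d' [e' dE']].
exists (fun i => d i + d' (p.1 i)), (fun j => e j + e' (p.2 j)) => i j.
by rewrite !permM -!trop_mulE -mulrA dE' mulrA dE mulrA.
Qed.

Canonical sym_group := Group sym_group_set.

Local Notation G := (subg_of sym_group).

Definition sym_act1 (i : I) (g : G) : I := (sgval g).1 i.
Definition sym_act2 (j : J) (g : G) : J := (sgval g).2 j.

Fact sym_act1_id i : sym_act1 i 1%g = i. Proof. by rewrite /sym_act1 perm1. Qed.
Fact sym_act2_id j : sym_act2 j 1%g = j. Proof. by rewrite /sym_act2 perm1. Qed.
Fact sym_act1_morph i : act_morph sym_act1 i.
Proof. by move=> g g'; rewrite /sym_act1 permM. Qed.
Fact sym_act2_morph j : act_morph sym_act2 j.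
Proof. by move=> g g'; rewrite /sym_act2 permM. Qed.

Definition sym_action1 : {action G &-> I} := TotalAction sym_act1_id sym_act1_morph.
Definition sym_action2 : {action G &-> J} := TotalAction sym_act2_id sym_act2_morph.

(** Averaging the scalings over the finite group [G] rescales [B] to a matrix
    whose finite entries are the means of [B] over [G]-orbits, hence invariant. *)
Lemma sym_normalize : exists (d : I -> R) (e : J -> R), forall g i j,
  (d (sym_act1 i g))%:T * B (sym_act1 i g) (sym_act2 j g) * (e (sym_act2 j g))%:T =
  (d i)%:T * B i j * (e j)%:T.
Proof.
have scal (g : G) : exists de : (I -> R) * (J -> R), forall i j,
    (de.1 i)%:T * B (sym_act1 i g) (sym_act2 j g) = B i j * (de.2 j)%:T.
  by have := subgP g; rewrite !inE => -[d [e dE]]; exists (d, e).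
have [de deP] := choice scal.
pose N : R := #|G|%:R.
have N0 : N != 0 by rewrite pnatr_eq0 -lt0n; apply/card_gt0P; exists 1%g.
pose b i j := trop_val (B i j).
pose d i := - (\sum_(g : G) (de g).1 i) / N; pose e j := (\sum_(g : G) (de g).2 j) / N.
have mean i j : B i j != 0 ->
    d i + b i j + e j = (\sum_(g : G) b (sym_act1 i g) (sym_act2 j g)) / N.
  move=> nz; rewrite (eq_bigr (fun g => b i j + ((de g).2 j - (de g).1 i))); last first.
    move=> g _; have := deP g i j; rewrite /b (trop_valK nz) trop_mulE.
    by case: (B (sym_act1 i g) _) => //= c; rewrite trop_mulE => -[E]; lra.
  rewrite big_split /= sumr_const sumrB -mulr_natr /d /e.
  rewrite cardE -cardT; change (#|G|%:R) with N.
  by field.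
exists d, e => g i j; have [z|nz] := eqVneq (B i j) 0.
  have := deP g i j; rewrite z; case: (B (sym_act1 i g) _) => //=.
have nz' : B (sym_act1 i g) (sym_act2 j g) != 0.
  by apply: contraNneq nz => z'; have := deP g i j; rewrite z' mulr0; case: (B i j).
rewrite (trop_valK nz) (trop_valK nz') !trop_mulE -/(b _ _) -/(b _ _) !mean //.
congr (Some (_ / N)); rewrite [RHS](reindex_inj (mulgI g)) /=; apply: eq_bigr => g' _.
by rewrite (sym_act1_morph i g g') (sym_act2_morph j g g').
Qed.

End Group.

(** A faithful action of the symmetries on rows alone, or on columns alone, comes
    from irredundance: distinct columns are not proportional.  The group is
    paired 2-closed since the normalised matrix is constant on orbits of pairs,
    so that preserving these orbits implies preserving the matrix. *)
Theorem symmetrize (I J : finType) (B : I -> J -> T) :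
  irredundant B -> irredundant (transpose B) ->
  exists (G : finGroupType) (to1 : {action G &-> I}) (to2 : {action G &-> J})
         (B' : I -> J -> T),
    [/\ mon_equiv B' B, symmetry_group to1 to2 B',
        [faithful [set: G], on [set: I] | to1],
        [faithful [set: G], on [set: J] | to2] & paired_2closed to1 to2].
Proof.
move=> irrB irrBt; have [d [e inv]] := sym_normalize B.
pose B' i j := (d i)%:T * B i j * (e j)%:T.
have invB' (g : subg_of (sym_group B)) i j : B' (sym_act1 i g) (sym_act2 j g) = B' i j.
  exact: inv.
have BB' : mon_equiv B' B.
  exists (fun i => (i, d i)); split; first by exists id.
  exists id, (fun j => - e j); split=> [|i j]; first by exists id.
  by rewrite /B' -mulrA trop_mulE subrr mulr1.
have irrB' : irredundant B' by apply: irredundant_equiv irrB; apply: mon_equiv_sym.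
have irrB't : irredundant (transpose B').
  by apply: irredundant_equiv irrBt; apply/mon_equiv_transpose/mon_equiv_sym.
have scal0 (x : T) : x = 0%:T * x by rewrite mul1r.
have faith1 (g : subg_of (sym_group B)) : (forall i, sym_act1 i g = i) -> g = 1%g.
  move=> fix1; apply/val_inj/injective_projections; apply/permP => i.
    by rewrite [LHS]fix1 [RHS]perm1.
  transitivity i; last by symmetry; apply: perm1.
  apply: (irredundant_inj (c := 0) irrB't) => j.
  by rewrite -scal0 /transpose -[RHS](invB' g) fix1.
have faith2 (g : subg_of (sym_group B)) : (forall j, sym_act2 j g = j) -> g = 1%g.
  move=> fix2; apply/val_inj/injective_projections; apply/permP => i.
    transitivity i; last by symmetry; apply: perm1.
    apply: (irredundant_inj (c := 0) irrB') => j.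
    by rewrite -scal0 -[RHS](invB' g) fix2.
  by rewrite [LHS]fix2 [RHS]perm1.
have aut (s : I -> I) (t : J -> J) (d' : I -> R) (e' : J -> R) :
    bijective s -> bijective t ->
    (forall i j, (d' i)%:T * B' (s i) (t j) = B' i j * (e' j)%:T) ->
    exists g : subg_of (sym_group B),
      (forall i, s i = sym_act1 i g) /\ (forall j, t j = sym_act2 j g).
  move=> sbij tbij E.
  have pS : (perm (bij_inj sbij), perm (bij_inj tbij)) \in sym_group B.
    rewrite !inE.
    exists (fun i => d' i + d (s i) - d i), (fun j => e j + e' j - e (t j)) => i j /=.
    rewrite !permE; have := E i j; rewrite /B'.
    case: (B (s i) (t j)) (B i j) => [x|] [y|] //=.
    by rewrite !trop_mulE => -[E']; congr Some; lra.
  by exists (subg _ (perm (bij_inj sbij), perm (bij_inj tbij))); split=> i;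
    rewrite /sym_act1 /sym_act2 subgK //= permE.
exists (subg_of (sym_group B)), (sym_action1 B), (sym_action2 B), B'.
split=> //.
- apply/faithfulP => g _ fix1; apply: faith1 => i; exact: (fix1 i).
- apply/faithfulP => g _ fix2; apply: faith2 => i; exact: (fix2 i).
move=> s t pres.
have [|||g [sg tg]] := aut s t (fun=> 0) (fun=> 0).
- exact: injF_bij perm_inj.
- exact: injF_bij perm_inj.
- move=> i j; rewrite -scal0 mulrC -scal0.
  have : (s i, t j) \in pair_orbit (sym_action1 B) (sym_action2 B) (i, j).
    rewrite -(pres (i, j)); apply: imset_f (i, j) _.
    by apply/imsetP; exists 1%g => //; rewrite !act1.
  by move=> /imsetP[g _ [-> ->]]; apply: invB'.
exists g; split; apply/permP => i; rewrite actpermE ?sg ?tg //.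
Qed.

End Symmetrize.

(** * Blocks with at most two rows or columns *)

Section SmallBlocks.
Variable R : realType.
Local Open Scope ring_scope.
Local Notation T := (tropical R).

Lemma eq_card_bijective (X Y : finType) : #|X| = #|Y| -> exists f : X -> Y, bijective f.
Proof.
move=> XY; exists (fun x => enum_val (cast_ord XY (enum_rank x))).
exists (fun y => enum_val (cast_ord (esym XY) (enum_rank y))) => x.
  by rewrite enum_valK cast_ordK enum_rankK.
by rewrite enum_valK cast_ordKV enum_rankK.
Qed.

Lemma relabel_equiv (I J I' J' : finType) (B : I -> J -> T) (f : I' -> I) (g : J' -> J) :
  bijective f -> bijective g -> mon_equiv (fun i j => B (f i) (g j)) B.
Proof.
move=> fbij gbij; exists (fun i => (f i, 0)); split=> //.
by exists g, (fun=> 0); split=> // i j; rewrite mulrC.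
Qed.

(** The witnessing rows of distinct columns are distinct when there are only
    two rows: two columns with the same witnessing row are compared in the other
    row, and each would have to exceed the other there. *)
Lemma two_rows_card (I J : finType) (B : I -> J -> T) :
  (#|I| <= 2)%N -> irredundant (transpose B) -> (#|J| <= #|I|)%N.
Proof.
move=> I2 irrBt; have [w wP] := choice irrBt.
suff wI : injective w by apply: leq_card wI.
move=> j j' ww; apply/eqP; apply: contraT => jj'.
have [_ /(_ j')[|l lt]] := wP j; first by rewrite eq_sym.
have [_ /(_ j jj')[l' lt']] := wP j'.
have lw : l != w j by apply: contraTneq lt => ->; rewrite mulrC ltxx.
have lw' : l' != w j by apply: contraTneq lt' => ->; rewrite ww mulrC ltxx.
have ll' : l = l'.
  apply/eqP; apply: contraLR I2 => ll'; rewrite -ltnNge.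
  have /card_uniqP E : uniq [:: w j; l; l'].
    by rewrite /= !inE negb_or ll' [w j == l]eq_sym [w j == l']eq_sym lw lw'.
  by apply: leq_trans (max_card (mem [:: w j; l; l'])); rewrite E.
move: lt lt'; rewrite /transpose -ll' -ww => lt lt'.
by have := lt_trans lt lt'; rewrite ltxx.
Qed.

Lemma small_block_card (I J : finType) (B : I -> J -> T) :
  irredundant B -> irredundant (transpose B) -> (minn #|I| #|J| <= 2)%N ->
  #|I| = #|J|.
Proof.
move=> irrB irrBt; rewrite geq_min => small.
have IJ := @two_rows_card _ _ B; have JI := @two_rows_card _ _ (transpose B).
apply/eqP; rewrite eqn_leq; case/orP: small => small.
  by have JleI := IJ small irrBt; rewrite JleI andbT JI // (leq_trans JleI).
by have IleJ := JI small irrB; rewrite IleJ IJ // (leq_trans IleJ).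
Qed.

(** The single entry is finite and can be scaled to any other value. *)
Lemma unit_block_equiv (I J I' J' : finType) (B : I -> J -> T) (B' : I' -> J' -> T) :
  irredundant B -> irredundant B' -> #|I| = 1%N -> #|J| = 1%N ->
  #|I'| = 1%N -> #|J'| = 1%N -> mon_equiv B B'.
Proof.
move=> irrB irrB' /fintype1[i iE] /fintype1[j jE] /fintype1[i' i'E] /fintype1[j' j'E].
have [j1 [nz _]] := irrB i; have [j2 [nz' _]] := irrB' i'.
move: nz nz'; rewrite (jE j1) (j'E j2) => /trop_neq0[b Bij] /trop_neq0[b' B'ij].
exists (fun=> (i', b)); split; first by exists (fun=> i) => x /=; rewrite ?iE ?i'E.
exists (fun=> j'), (fun=> b'); split; first by exists (fun=> j) => x /=; rewrite ?jE ?j'E.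
by move=> x y; rewrite (iE x) (jE y) Bij B'ij.
Qed.

(** Triviality of the symmetry group, in a form that does not mention a
    normalisation of [B]. *)
Definition rigid (I J : finType) (B : I -> J -> T) : Prop :=
  forall u, mon_iso B B u -> forall i, (u i).1 = i.

Lemma rigid_equiv (I J I' J' : finType) (B : I -> J -> T) (B' : I' -> J' -> T) :
  mon_equiv B B' -> rigid B -> rigid B'.
Proof.
move=> [a aP] rigB u uP i'; have [b [bP ab ba]] := mon_iso_inv aP.
have := rigB _ (mon_iso_comp aP (mon_iso_comp uP bP)) (b i').1.
have aK i : (a (b i).1).1 = i by have := congr1 (fun v => (v i).1) ba.
have bK i : (b (a i).1).1 = i by have := congr1 (fun v => (v i).1) ab.
by move=> /= E; rewrite -[RHS]aK -E !aK.
Qed.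

Lemma rigid_symmetry_group (G : finGroupType) (I J : finType) (B : I -> J -> T)
    (to1 : {action G &-> I}) (to2 : {action G &-> J}) :
  #|G| = 1%N -> symmetry_group to1 to2 B -> rigid B.
Proof.
move=> /fintype1[g0 G1] [_ _ autB] u [ubij [t [e [tbij ue]]]] i.
have [g [-> _]] := autB _ _ _ _ ubij tbij ue.
by rewrite (G1 g) -(G1 1%g) act1.
Qed.

(** The entries are -oo in one corner and the real number 0 elsewhere. *)
Definition corner (i j : bool) : T := if i && j then 0 else 1.

(** A [2 x 2] block without infinite entries has the automorphism which
    exchanges both the rows and the columns. *)
Lemma rigid_bool_block (B : bool -> bool -> T) :
  irredundant B -> irredundant (transpose B) -> connected_block B -> rigid B ->
  mon_equiv B corner.
Proof.
move=> irrB irrBt conn rig.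
(* Two infinite entries would leave a zero row or column, or disconnect. *)
have [a [b [Bab fin]]] : exists a b, B a b = 0 /\
    forall i j, (i, j) != (a, b) -> B i j != 0.
  have row i : ~ (B i true = 0 /\ B i false = 0).
    by move=> [Bt Bf]; have [[] [] ] := irrB i; rewrite ?Bt ?Bf.
  have col j : ~ (B true j = 0 /\ B false j = 0).
    by move=> [Bt Bf]; have [[] [] ] := irrBt j; rewrite /transpose ?Bt ?Bf.
  have diag (c : bool) : ~ (forall i j, B i j != 0 -> i = (j (+) c)).
    by move=> Bd; have := conn _ id (fun j => j (+) c) Bd true false.
  case Ett: (B true true) (row true) (row false) (col true) (col false)
    (diag false) (diag true) => [x|];
  case Etf: (B true false) => [y|]; case Eft: (B false true) => [z|];
  case Eff: (B false false) => [w|] r1 r2 c1 c2 d1 d2; try by [case: r1|case: r2|case: c1|case: c2].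
  - have : mon_iso B B (fun i => (~~ i, if i then 0 else z + w - x - y)).
      split; first by exists negb => i; rewrite /= negbK.
      exists negb, (fun j => if j then w - x else z - y); split.
        by exists negb => j; rewrite negbK.
      case=> -[] /=; rewrite ?Ett ?Etf ?Eft ?Eff !trop_mulE; congr Some; lra.
    by move=> /rig /(_ true).
  - by exists false, false; split=> // -[] [] //=; rewrite ?Ett ?Etf ?Eft ?Eff.
  - by exists false, true; split=> // -[] [] //=; rewrite ?Ett ?Etf ?Eft ?Eff.
  - by exists true, false; split=> // -[] [] //=; rewrite ?Ett ?Etf ?Eft ?Eff.
  - by case: d1 => -[] [] //=; rewrite ?Ett ?Etf ?Eft ?Eff.
  - by exists true, true; split=> // -[] [] //=; rewrite ?Ett ?Etf ?Eft ?Eff.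
  by case: d2 => -[] [] //=; rewrite ?Ett ?Etf ?Eft ?Eff.
pose v i j := trop_val (B i j).
exists (fun i => (i == a, v i (~~ b))); split.
  by exists (fun i => i == a) => i /=; case: i; case: a {Bab fin}.
exists (fun j => j == b), (fun j => if j == b then v (~~ a) (~~ b) - v (~~ a) b else 0); split.
  by exists (fun j => j == b) => i /=; case: i; case: b {Bab fin}.
move=> i j; have [ab|ab] := eqVneq (i, j) (a, b).
  by case: ab => -> ->; rewrite Bab /corner /= !eqxx mulr0.
rewrite (trop_valK (fin _ _ ab)) -/(v i j) /corner /=.
rewrite -[(i == a) && _]xpair_eqE (negPf ab) mulr1 trop_mulE; congr Some.
rewrite xpair_eqE negb_and in ab; case: (eqVneq j b) ab => [->|jb] /=.
  rewrite orbF => ia; have -> : i = ~~ a by case: i a ia {v fin Bab} => -[].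
  lra.
by have -> : j = ~~ b by [case: j b jb {v fin Bab} => -[]]; move=> _; rewrite addr0.
Qed.

Lemma rigid_two_block (I J : finType) (B : I -> J -> T) :
  irredundant B -> irredundant (transpose B) -> connected_block B -> rigid B ->
  minn #|I| #|J| = 2%N -> mon_equiv B corner.
Proof.
move=> irrB irrBt conn rig IJ.
have cIJ : #|I| = #|J| by apply: small_block_card irrB irrBt _; rewrite IJ.
have cJ : #|J| = #|{: bool}| by move: IJ; rewrite cIJ minnn card_bool.
have [f fbij] := eq_card_bijective (esym (etrans cIJ cJ)).
have [g gbij] := eq_card_bijective (esym cJ).
have equiv := mon_equiv_sym (relabel_equiv B fbij gbij).
apply: (mon_equiv_trans equiv); apply: rigid_bool_block.
- exact: irredundant_equiv equiv irrB.
- exact: irredundant_equiv (mon_equiv_transpose equiv) irrBt.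
- exact: connected_equiv equiv conn.
exact: rigid_equiv equiv rig.
Qed.

End SmallBlocks.

(** * Triangular blocks without symmetry *)

Section Triangular.
Variable R : realType.
Local Open Scope ring_scope.
Local Notation T := (tropical R).

(** The supports of the rows form a chain, which leaves no room for a symmetry.
    From size [3] on the entry [t] cannot be scaled away. *)
Definition tri (k : nat) (t : R) (i j : 'I_k) : T :=
  if (j <= i)%N then (t *+ ((i == 2%N :> nat) && (j == 0%N :> nat)))%:T else 0.

Lemma tri_neq0 k t (i j : 'I_k) : (tri t i j != 0) = (j <= i)%N.
Proof. by rewrite /tri; case: leqP. Qed.

Lemma irredundant_triangular (I : finType) (B : I -> I -> T) :
  (forall i, B i i != 0) -> (forall i k, k != i -> B i k = 0 \/ B k i = 0) ->
  irredundant B.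
Proof.
move=> diag tri0 i; exists i; split=> // l li; exists l.
rewrite (_ : B i l * B l i = 0) ?trop_lt0x ?trop_mul_eq0 ?negb_or ?diag //.
by case: (tri0 i l li) => ->; rewrite ?mul0r ?mulr0.
Qed.

Lemma tri_eq0 k t (i j : 'I_k) : j != i -> tri t i j = 0 \/ tri t j i = 0.
Proof.
rewrite /tri neq_ltn => /orP[lt|lt]; [right | left];
  by rewrite leqNgt lt.
Qed.

Lemma irredundant_tri k t : irredundant (@tri k t).
Proof.
by apply: irredundant_triangular => [i|]; [rewrite tri_neq0 | exact: tri_eq0].
Qed.

Lemma irredundant_tri_tr k t : irredundant (transpose (@tri k t)).
Proof.
apply: irredundant_triangular => [i|i j ji]; first by rewrite /transpose tri_neq0.
by have [] := tri_eq0 t ji; [right | left].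
Qed.

Lemma connected_tri k t : connected_block (@tri k t).
Proof.
move=> X f g fg i i'; case: k f g fg i i' => [|k] f g fg i i'; first by case: i.
by rewrite (fg i ord0) ?(fg i' ord0) // tri_neq0.
Qed.

Lemma card_row_tri k t (i : 'I_k) : #|[pred j | tri t i j != 0]| = i.+1.
Proof.
rewrite -sum1_card (eq_bigl (fun j : 'I_k => (j < i.+1)%N)); last first.
  by move=> j; rewrite inE tri_neq0.
by rewrite (big_ord_narrow (ltn_ord i)) sum1_card card_ord.
Qed.

(** The number of finite entries determines a row, and then the supports of the
    rows determine the columns. *)
Lemma tri_iso_id k t t' (f g : 'I_k -> 'I_k) (d e : 'I_k -> R) :
  bijective g ->
  (forall i j, (d i)%:T * tri t' (f i) (g j) = tri t i j * (e j)%:T) ->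
  (forall i, f i = i) /\ (forall j, g j = j).
Proof.
move=> gbij fg.
have supp i j : (g j <= f i)%N = (j <= i)%N.
  rewrite -(tri_neq0 t') -(tri_neq0 t); have := fg i j.
  by case: (tri t' _ _) (tri t _ _) => [x|] [y|].
have fE i : f i = i.
  apply/val_inj/eq_add_S; rewrite -(card_row_tri t) -(card_row_tri t).
  rewrite -(on_card_preimset (f := g)); last exact: onW_bij.
  by apply: eq_card => j; rewrite !inE !tri_neq0 supp.
split=> // j; apply/val_inj/eqP; rewrite eqn_leq.
by have := supp j j; have := supp (g j) j; rewrite !fE !leqnn => <- ->.
Qed.

(** The entry [t] is the cross difference of rows 1, 2 and columns 0, 1. *)
Lemma tri_equiv k k' t t' : mon_equiv (@tri k t) (@tri k' t') ->
  k = k' /\ (k = 3 -> t = t').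
Proof.
move=> [u [ubij [g [e [gbij ue]]]]].
have kk' : k = k' by have := bij_eq_card gbij; rewrite !card_ord.
split=> //; subst k' => k3; subst k.
have [uE gE] := tri_iso_id gbij ue.
pose o (i : nat) (lt : (i < 3)%N) := Ordinal lt.
have := ue (@o 1 isT) (@o 0 isT); have := ue (@o 1 isT) (@o 1 isT).
have := ue (@o 2 isT) (@o 0 isT); have := ue (@o 2 isT) (@o 1 isT).
rewrite !uE !gE /tri /= !mulr0n !mulr1n !trop_mulE => -[E1] [E2] [E3] [E4].
lra.
Qed.

Section TrivialAction.
Variables (G : finGroupType) (X : Type).

Fact triv_act1 (x : X) : (fun (x : X) (g : G) => x) x 1%g = x. Proof. by []. Qed.
Fact triv_actM (x : X) : act_morph (fun (x : X) (g : G) => x) x. Proof. by []. Qed.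
Definition trivial_action : {action G &-> X} := TotalAction triv_act1 triv_actM.

End TrivialAction.

Lemma symmetry_group_tri (G : finGroupType) k t : #|G| = 1%N ->
  symmetry_group (trivial_action G 'I_k) (trivial_action G 'I_k) (tri t).
Proof.
move=> /fintype1[g0 G1]; split=> // [g _|s t' d e _ tbij E]; first by rewrite (G1 g) -(G1 1%g).
by have [sE tE] := tri_iso_id tbij E; exists 1%g.
Qed.

End Triangular.

(** * Pairs of actions *)

Section PairActions.
Variable G : finGroupType.

Section Pair.
Variables (X Y : finType) (to1 : {action G &-> X}) (to2 : {action G &-> Y}).

Definition same_orbit (i : X) (j : Y) (i' : X) (j' : Y) : Prop :=
  exists g : G, to1 i g = i' /\ to2 j g = j'.

Lemma same_orbit_refl i j : same_orbit i j i j.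
Proof. by exists 1%g; rewrite !act1. Qed.

Lemma same_orbit_act i j g : same_orbit i j (to1 i g) (to2 j g).
Proof. by exists g. Qed.

Lemma same_orbit_sym i j i' j' : same_orbit i j i' j' -> same_orbit i' j' i j.
Proof. by move=> [g [<- <-]]; exists g^-1%g; rewrite !actK. Qed.

Lemma same_orbit_trans i j i' j' i2 j2 :
  same_orbit i j i' j' -> same_orbit i' j' i2 j2 -> same_orbit i j i2 j2.
Proof. by move=> [g [<- <-]] [h [<- <-]]; exists (g * h)%g; rewrite !actM. Qed.

Lemma pair_orbitE i j i' j' :
  pair_orbit to1 to2 (i, j) = pair_orbit to1 to2 (i', j') <-> same_orbit i j i' j'.
Proof.
split=> [E|[g [<- <-]]].
  have : (i', j') \in pair_orbit to1 to2 (i, j).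
    by rewrite E; apply/imsetP; exists 1%g => //; rewrite !act1.
  by move=> /imsetP[g _ [-> ->]]; exists g.
apply/setP => p; apply/imsetP/imsetP => -[h _ ->] /=.
  by exists (g^-1 * h)%g => //=; rewrite -!actM mulKVg.
by exists (g * h)%g => //=; rewrite !actM.
Qed.

Definition faithful_action (Z : finType) (to : {action G &-> Z}) : Prop :=
  forall g, (forall x, to x g = x) -> g = 1%g.

Definition pair_closed : Prop :=
  forall (s : X -> X) (t : Y -> Y), injective s -> injective t ->
    (forall i j, same_orbit i j (s i) (t j)) ->
    exists g, (forall i, to1 i g = s i) /\ (forall j, to2 j g = t j).

(** A pair of permutations preserves the orbits as sets as soon as it moves each
    pair within its orbit. *)
Lemma paired_2closedP : paired_2closed to1 to2 -> pair_closed.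
Proof.
move=> closed s t sI tI st.
have [|g [sg tg]] := closed (perm sI) (perm tI).
  move=> [i j]; have pI : injective (fun q : X * Y => (perm sI q.1, perm tI q.2)).
    by case=> [x y] [x' y'] /= E; case: E => /perm_inj -> /perm_inj ->.
  apply/eqP; rewrite eqEcard (card_imset _ pI).
  rewrite leqnn andbT; apply/fintype.subsetP => _ /imsetP[[x y] /imsetP[g _ [xE yE]] ->] /=.
  rewrite !permE; have [h [<- <-]] := st x y; rewrite xE yE -!actM.
  by apply/imsetP; exists (g * h)%g.
by exists g; split=> [i|j]; rewrite -actpermE ?sg ?tg permE.
Qed.

(** A transposition of two columns which no row tells apart would preserve all
    the orbits of pairs and fix all the rows. *)
Lemma separated_columns : faithful_action to1 -> pair_closed ->
  forall j k, (forall i, same_orbit i j i k) -> j = k.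
Proof.
move=> faith closed j k jk.
have [|||g [g1 g2]] := closed id (tperm j k).
- by [].
- exact: perm_inj.
- move=> i y; case: tpermP => [->|->|_ _] //; last exact: same_orbit_refl.
  exact: same_orbit_sym.
by have := g2 j; rewrite (faith g) // act1 tpermL.
Qed.

End Pair.

Lemma same_orbit_swap (X Y : finType) (to1 : {action G &-> X}) (to2 : {action G &-> Y})
  i j i' j' : same_orbit to1 to2 i j i' j' -> same_orbit to2 to1 j i j' i'.
Proof. by move=> [g [gi gj]]; exists g. Qed.

Lemma pair_closed_swap (X Y : finType) (to1 : {action G &-> X}) (to2 : {action G &-> Y}) :
  pair_closed to1 to2 -> pair_closed to2 to1.
Proof.
move=> closed s t sI tI st; have [|g [g1 g2]] := closed t s tI sI; last by exists g.
by move=> i j; apply: same_orbit_swap.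
Qed.

Definition closed_pair (X Y : finType) (to1 : {action G &-> X}) (to2 : {action G &-> Y}) :=
  [/\ faithful_action to1, faithful_action to2 & pair_closed to1 to2].

Lemma closed_pair_swap (X Y : finType) (to1 : {action G &-> X}) (to2 : {action G &-> Y}) :
  closed_pair to1 to2 -> closed_pair to2 to1.
Proof. by move=> [f1 f2 /pair_closed_swap c]. Qed.

Section SubAction.
Variables (Y : finType) (to : {action G &-> Y}) (S : {set Y}).
Hypothesis inv : forall y g, y \in S -> to y g \in S.

Let act (y : {y | y \in S}) (g : G) : {y | y \in S} := Sub (to (val y) g) (inv g (valP y)).

Fact sub_act1 y : act y 1%g = y. Proof. by apply: val_inj; rewrite /= act1. Qed.
Fact sub_actM y : act_morph act y.
Proof. by move=> g h; apply: val_inj; rewrite /= actM. Qed.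
Definition sub_action : {action G &-> {y | y \in S}} := TotalAction sub_act1 sub_actM.

End SubAction.

Section Drop.
Variables (X Y : finType) (to1 : {action G &-> X}) (to2 : {action G &-> Y}) (S : {set Y}).
Hypothesis closed : closed_pair to1 to2.
Hypothesis inv : forall y g, y \in S -> to2 y g \in S.

(** Columns can be dropped when the action on the rest is still faithful and
    every orbit-preserving bijection of the rest extends to the dropped ones. *)
Lemma closed_pair_drop :
  (forall g, (forall y, y \in S -> to2 y g = y) -> g = 1%g) ->
  (forall (s : X -> X) (t : Y -> Y), injective t -> (forall y, y \in S -> t y \in S) ->
     (forall i j, j \in S -> same_orbit to1 to2 i j (s i) (t j)) ->
     exists t' : Y -> Y, [/\ injective t', forall y, y \in S -> t' y = t y &
       forall i j, j \notin S -> same_orbit to1 to2 i j (s i) (t' j)]) ->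
  closed_pair to1 (sub_action inv).
Proof.
move=> faith ext; have [f1 f2 c12] := closed; split=> //.
  move=> g fixS; apply: faith => y yS.
  exact: (congr1 val (fixS (Sub y yS))).
move=> s t sI tI st.
pose t1 y := if insub y is Some y' then val (t y') else y.
have valS y (yS : y \in S) : val (Sub y yS : {y | y \in S}) = y by [].
have t1S (y : {y | y \in S}) : t1 (val y) = val (t y) by rewrite /t1 valK.
have t1in y : y \in S -> t1 y \in S.
  by move=> yS; rewrite -[y](valS y yS) t1S; apply: valP.
have t1out y : y \notin S -> t1 y = y by move=> yS; rewrite /t1 insubN.
have [|||t' [t'I t'S t'out]] := ext s t1.
- move=> y y'; have [yS|yS] := boolP (y \in S); have [yS'|yS'] := boolP (y' \in S).
  + rewrite -[y](valS y yS) -[y'](valS y' yS') !t1S => E.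
    by congr val; apply/tI/val_inj.
  + by rewrite (t1out y') // => E; have := t1in _ yS; rewrite E (negPf yS').
  + by rewrite (t1out y) // => E; have := t1in _ yS'; rewrite -E (negPf yS).
  by rewrite !t1out.
- exact: t1in.
- move=> i y yS; rewrite -[y](valS y yS) t1S.
  by have [g [gi gj]] := st i (Sub y yS); exists g; rewrite gi -gj.
have [|g [g1 g2]] := c12 s t' sI t'I.
  move=> i j; have [jS|jS] := boolP (j \in S); last exact: t'out.
  rewrite t'S // -[j](valS j jS) t1S.
  by have [g [gi gj]] := st i (Sub j jS); exists g; rewrite gi -gj.
exists g; split=> // y; apply: val_inj; rewrite /= -t1S -t'S ?g2 //.
exact: valP.
Qed.

End Drop.

Definition no_fixed_point (Z : finType) (to : {action G &-> Z}) : Prop :=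
  forall x, exists g, to x g != x.

Definition distinct_orbits (Z : finType) (to : {action G &-> Z}) : Prop :=
  forall x y, (forall g, to x g = x <-> to y g = y) -> exists g, to x g = y.

Hypothesis G_neq1 : exists g : G, g != 1%g.

(** A fixed column only records the orbits of the rows, and these are seen in any
    other column. *)
Lemma drop_fixed_point (X Y : finType) (to1 : {action G &-> X}) (to2 : {action G &-> Y})
    (x0 : Y) :
  closed_pair to1 to2 -> (forall g, to2 x0 g = x0) ->
  exists (Y' : finType) (to2' : {action G &-> Y'}),
    (#|Y'| < #|Y|)%N /\ closed_pair to1 to2'.
Proof.
move=> closed fixx; have [f1 f2 c12] := closed; pose S := [set~ x0].
have inv y g : y \in S -> to2 y g \in S.
  by rewrite !inE; apply: contra => /eqP E; rewrite -(actK to2 g y) /= E fixx.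
exists {y | y \in S}, (sub_action inv); split.
  by rewrite card_sig cardsC1 prednK //; apply/card_gt0P; exists x0.
apply: closed_pair_drop => //.
  move=> g fixS; apply: f2 => y; have [->|yx] := eqVneq y x0; first exact: fixx.
  by apply: fixS; rewrite !inE.
move=> s t tI tS st; have [g0 g0N] := G_neq1.
have [y yS] : exists y, y \in S.
  apply: contrapT => none; move/eqP: g0N; apply; apply: f2 => y.
  have [->|yx] := eqVneq y x0; first exact: fixx.
  by case: none; exists y; rewrite !inE.
exists (fun y => if y \in S then t y else y); split.
- move=> a b; case: ifP => aS; case: ifP => bS //; first exact: tI.
    by move=> E; have := tS _ aS; rewrite E bS.
  by move=> E; have := tS _ bS; rewrite -E aS.
- by move=> z ->.
move=> i j jS; rewrite (negPf jS); move: jS; rewrite !inE negbK => /eqP->.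
by have [g [gi _]] := st i y yS; exists g.
Qed.

(** Two isomorphic orbits of columns: one of them can be permuted in the way of
    the other. *)
Lemma drop_isomorphic_orbit (X Y : finType) (to1 : {action G &-> X}) (to2 : {action G &-> Y})
    (j k : Y) :
  closed_pair to1 to2 -> (forall g, to2 j g = j <-> to2 k g = k) ->
  ~ (exists g, to2 j g = k) ->
  exists (Y' : finType) (to2' : {action G &-> Y'}),
    (#|Y'| < #|Y|)%N /\ closed_pair to1 to2'.
Proof.
move=> closed stab jk; have [f1 f2 c12] := closed.
pose S : {set Y} := [set y | ~~ `[< exists g, to2 k g = y >]].
have SP y : reflect (exists g, to2 k g = y) (y \notin S).
  by rewrite inE negbK; apply: asboolP.
(* [to2 j a |-> to2 k a] is an isomorphism between the two orbits. *)
have stabE a b : to2 j a = to2 j b <-> to2 k a = to2 k b.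
  have E (y : Y) : to2 y a = to2 y b <-> to2 y (a * b^-1)%g = y.
    rewrite actM; split=> [->|E]; first by rewrite actK.
    by rewrite -[in RHS]E actKV.
  by rewrite !E.
have jS : j \in S.
  by apply: contraT => /SP[g kg]; case: jk; exists g^-1%g; rewrite -kg actK.
have inv y g : y \in S -> to2 y g \in S.
  move=> yS; apply: contraT => /SP[h kh].
  by move: yS; rewrite -[_ \in _]negbK; case: SP => // -[]; exists (h * g^-1)%g;
    rewrite actM kh actK.
have kS : k \notin S by apply/SP; exists 1%g; rewrite act1.
exists {y | y \in S}, (sub_action inv); split.
  rewrite card_sig -(cardsT Y); apply: proper_card; rewrite properE finset.subsetT /=.
  by apply/fintype.subsetPn; exists k.
apply: closed_pair_drop => //.
  move=> g fixS; apply: f2 => y; have [yS|/SP[h <-]] := boolP (y \in S).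
    exact: fixS.
  by rewrite -actM; apply/stabE; rewrite actM; apply/fixS/inv.
move=> s t tI tS st.
have [gk gkE] : exists gk : Y -> G, forall y, y \notin S -> to2 k (gk y) = y.
  suff H y : exists g, y \notin S -> to2 k g = y by have [f fP] := choice H; exists f.
  by have [yS|/SP[h hE]] := boolP (y \in S); [exists 1%g | exists h].
have [gj gjE] : exists gj : Y -> G, forall y g, to2 j g = y -> to2 j (gj y) = y.
  suff H y : exists a, forall g, to2 j g = y -> to2 j a = y by have [f fP] := choice H; exists f.
  have [[g jg]|no] := pselect (exists g, to2 j g = y); first by exists g.
  by exists 1%g => g jg; case: no; exists g.
have ttE g : to2 j (gj (t (to2 j g))) = t (to2 j g).
  have [i0 _|X0] := pickP (fun _ : X => true).
    by have [h [_ hE]] := st i0 _ (inv _ g jS); apply: (gjE _ (g * h)%g); rewrite actM.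
  have [g0 /eqP[]] := G_neq1.
  by apply: f1 => x; have := X0 x.
(* The permutation of the orbit of [j], transported to the orbit of [k]. *)
pose t' y := if y \in S then t y else to2 k (gj (t (to2 j (gk y)))).
exists t'; rewrite /t'; split.
- move=> a b; case: ifPn => aS; case: ifPn => bS; first exact: tI.
  + by move=> E; have /SP[] := tS _ aS => //; rewrite E; exists (gj (t (to2 j (gk b)))).
  + by move=> E; have /SP[] := tS _ bS => //; rewrite -E; exists (gj (t (to2 j (gk a)))).
  rewrite -stabE !ttE => /tI /stabE.
  by rewrite !gkE.
- by move=> y ->.
move=> i y yS; rewrite (negPf yS).
have [h [hi hj]] := st i _ (inv _ (gk y) jS).
exists h; split=> //; rewrite -{1}(gkE y yS) -actM; apply/stabE.
by rewrite ttE -hj actM.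
Qed.

Lemma shrink_columns (X Y : finType) (to1 : {action G &-> X}) (to2 : {action G &-> Y}) :
  closed_pair to1 to2 ->
  (no_fixed_point to2 /\ distinct_orbits to2) \/
  exists (Y' : finType) (to2' : {action G &-> Y'}),
    (#|Y'| < #|Y|)%N /\ closed_pair to1 to2'.
Proof.
move=> closed.
have [fixd|/existsNP[x /forallNP nfix]] := pselect (no_fixed_point to2); last first.
  right; apply: (drop_fixed_point (x0 := x) closed) => g.
  by apply/eqP; apply: contraT => gx; case: (nfix g).
have [dist|/existsNP[j /existsNP[k /not_implyP[stab jk]]]] :=
  pselect (distinct_orbits to2); first by left.
by right; apply: (drop_isomorphic_orbit closed stab).
Qed.

Lemma shrink_pair (X Y : finType) (to1 : {action G &-> X}) (to2 : {action G &-> Y}) :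
  closed_pair to1 to2 ->
  exists (X' Y' : finType) (to1' : {action G &-> X'}) (to2' : {action G &-> Y'}),
    [/\ (#|X'| <= #|X|)%N, (#|Y'| <= #|Y|)%N, closed_pair to1' to2',
        no_fixed_point to1' /\ distinct_orbits to1' &
        no_fixed_point to2' /\ distinct_orbits to2'].
Proof.
have [N] := ubnP (#|X| + #|Y|); elim: N X Y to1 to2 => // N IH X Y to1 to2.
rewrite ltnS => leN closed.
have [tight2|[Y' [to2' [ltY closed']]]] := shrink_columns closed; last first.
  have [|X2 [Y2 [a [b [leX leY ? ? ?]]]]] := IH _ _ to1 to2' _ closed'.
    by apply: leq_trans leN; rewrite ltn_add2l.
  by exists X2, Y2, a, b; split=> //; apply: leq_trans leY (ltnW ltY).
have [tight1|[X' [to1' [ltX closed']]]] := shrink_columns (closed_pair_swap closed); last first.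
  have [|X2 [Y2 [a [b [leX leY ? ? ?]]]]] := IH _ _ to1' to2 _ (closed_pair_swap closed').
    by apply: leq_trans leN; rewrite ltn_add2r.
  by exists X2, Y2, a, b; split=> //; apply: leq_trans leX (ltnW ltX).
by exists X, Y, to1, to2.
Qed.

End PairActions.

(** * An irredundant invariant matrix *)

Section BaseMatrix.
Variable R : realType.
Variable G : finGroupType.
Local Open Scope ring_scope.

Definition irredundant_real (I J : finType) (A : I -> J -> R) : Prop :=
  forall i, exists j, forall k, k != i ->
    exists l, A i l + A k j < A k l + A i j.

Lemma irredundant_realP (I J : finType) (A : I -> J -> R) :
  (0 < #|J|)%N ->
  irredundant_real A -> irredundant (fun i j => (A i j)%:T).
Proof.
move=> /card_gt0P[j0 _] irrA i; have [j irr] := irrA i; exists j; split=> // k ki.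
by have [l lt] := irr _ ki; exists l; rewrite !trop_mulE trop_ltE.
Qed.

Definition invariant (X Y : finType) (to1 : {action G &-> X}) (to2 : {action G &-> Y})
    (A : X -> Y -> R) : Prop :=
  forall g i j, A (to1 i g) (to2 j g) = A i j.

Lemma sum_act (X : finType) (to : {action G &-> X}) g (F : X -> R) :
  \sum_x F (to x g) = \sum_x F x.
Proof. by rewrite [RHS](reindex_inj (act_inj to g)). Qed.

(** Two distinct columns with equal sums are incomparable entrywise. *)
Lemma exists_lt_of_eq_sum (X : finType) (F F' : X -> R) :
  \sum_x F x = \sum_x F' x -> F <> F' -> exists x, F x < F' x.
Proof.
move=> sumE neq; apply: contrapT => /forallNP le.
have ge0 x : 0 <= F x - F' x by rewrite subr_ge0 leNgt; apply/negP/le.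
apply: neq; apply/funext => x; apply/eqP; rewrite -subr_eq0.
have /psumr_eq0P H : forall x, true -> 0 <= F x - F' x by move=> y _; apply: ge0.
by apply/eqP; apply: H => //; rewrite sumrB sumE subrr.
Qed.

Section Pattern.
Variables (X Y : finType) (to1 : {action G &-> X}) (to2 : {action G &-> Y}).
Let O1 : {set {set X}} := [set orbit to1 [set: G] i | i : X].
Let O2 : {set {set Y}} := [set orbit to2 [set: G] j | j : Y].

(** One orbit of pairs is selected for each orbit of columns, in such a way that
    each orbit of rows is met; this requires at least as many orbits of columns
    as of rows. *)
Lemma zero_pattern : (#|O1| <= #|O2|)%N -> X ->
  exists Z : X -> Y -> bool,
    [/\ forall g i j, Z (to1 i g) (to2 j g) = Z i j,
        forall j, exists i, Z i j, forall i, exists j, Z i j &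
        forall i j i' g, Z i j -> Z i' (to2 j g) -> same_orbit to1 to2 i j i' (to2 j g)].
Proof.
move=> leO x0.
(* Orbits of columns are matched with orbits of rows by their positions in the
   enumerations. *)
pose S j := nth (finset.set0 : {set X}) (enum O1) (index (orbit to2 [set: G] j) (enum O2)).
pose F j := odflt x0 [pick i in S j].
pose r j := odflt j [pick k in orbit to2 [set: G] j].
have orbE j g : orbit to2 [set: G] (to2 j g) = orbit to2 [set: G] j.
  by apply/orbit_eqP/mem_orbit; rewrite inE.
have FE j g : F (to2 j g) = F j by rewrite /F /S orbE.
have rE j g : r (to2 j g) = r j.
  rewrite /r orbE; case: pickP => //= /(_ j).
  by rewrite orbit_refl.
have rP j : exists g, to2 (r j) g = j.
  rewrite /r; case: pickP => [k /orbitP[g _ <-]|_] /=; last by exists 1%g; rewrite act1.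
  by exists g^-1%g; rewrite actK.
have FP i : exists j g, to1 (F j) g = i.
  have iO : orbit to1 [set: G] i \in enum O1 by rewrite mem_enum imset_f.
  have lt : (index (orbit to1 [set: G] i) (enum O1) < size (enum O2))%N.
    by rewrite -cardE (leq_trans _ leO) // cardE index_mem.
  have := mem_nth (finset.set0 : {set Y}) lt; rewrite mem_enum => /imsetP[j _ jE].
  exists j; rewrite /F /S -jE index_uniq ?enum_uniq // nth_index //.
  case: pickP => [k /orbitP[g _ <-]|/(_ i)] /=; last by rewrite orbit_refl.
  by exists g^-1%g; rewrite actK.
pose Z i j := `[< same_orbit to1 to2 (F j) (r j) i j >].
exists Z; split.
- move=> g i j; rewrite /Z FE rE; apply: asbool_equiv_eq; split=> H.
    apply: (same_orbit_trans H); apply: same_orbit_sym; exact: same_orbit_act.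
  by apply: (same_orbit_trans H); apply: same_orbit_act.
- move=> j; have [g rg] := rP j; exists (to1 (F j) g); apply/asboolP.
  by exists g; rewrite rg.
- move=> i; have [j [g Fg]] := FP i; exists (to2 (r j) g); apply/asboolP.
  have [h rh] := rP j.
  have E : to2 j (h^-1 * g)%g = to2 (r j) g by rewrite actM -{1}rh actK.
  by rewrite -E FE rE; exists g.
move=> i j i' g /asboolP Hi /asboolP; rewrite FE rE => Hi'.
exact: same_orbit_trans (same_orbit_sym Hi) Hi'.
Qed.

Section FromPattern.
Variable Z : X -> Y -> bool.
Hypotheses (Zinv : forall g i j, Z (to1 i g) (to2 j g) = Z i j)
  (Zcol : forall j, exists i, Z i j) (Zrow : forall i, exists j, Z i j)
  (Zone : forall i j i' g, Z i j -> Z i' (to2 j g) ->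
     same_orbit to1 to2 i j i' (to2 j g)).
Hypotheses (sepX : forall i k, (forall j, same_orbit to1 to2 i j k j) -> i = k)
  (sepY : forall j k, (forall i, same_orbit to1 to2 i j i k) -> j = k)
  (nofixY : no_fixed_point to2) (distY : distinct_orbits to2).

(** Distinct positive weights on the orbits of pairs outside the pattern. *)
Let y i j : R :=
  if Z i j then 0 else (enum_rank (pair_orbit to1 to2 (i, j))).+1%:R.

Let y_inv : invariant to1 to2 y.
Proof.
move=> g i j; rewrite /y Zinv; case: ifP => // _.
by congr (enum_rank _).+1%:R; symmetry; apply/pair_orbitE; apply: same_orbit_act.
Qed.

Let y_ge0 i j : 0 <= y i j. Proof. by rewrite /y; case: ifP. Qed.

Let y_gt0 i j : ~~ Z i j -> 0 < y i j.
Proof. by rewrite /y => /negPf->; rewrite ltr0n. Qed.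

Let y_inj i j i' g : y i j = y i' (to2 j g) -> same_orbit to1 to2 i j i' (to2 j g).
Proof.
have [Zij|Zij] := boolP (Z i j); have [Zij'|Zij'] := boolP (Z i' (to2 j g)).
- by move=> _; apply: Zone.
- by have := y_gt0 Zij'; rewrite /y Zij => + E; rewrite -E ltxx.
- by have := y_gt0 Zij; rewrite /y Zij' => + E; rewrite E ltxx.
rewrite /y (negPf Zij) (negPf Zij') => /eqP; rewrite eqr_nat => /eqP [E].
by apply/pair_orbitE/enum_rank_inj/val_inj.
Qed.

Let S j := \sum_i y i j.

Let S_inv g j : S (to2 j g) = S j.
Proof. by rewrite /S -(sum_act to1 g); apply: eq_bigr => i _; rewrite y_inv. Qed.

(** A column which consists of pattern entries alone would be indistinguishable
    from its images under the group. *)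
Let S_gt0 j : 0 < S j.
Proof.
have [g gj] := nofixY j.
have [i Zij] : exists i, ~~ Z i j.
  apply: contrapT => /forallNP allZ; move/eqP: gj; apply; apply/esym/sepY => i.
  apply: Zone; first by apply: contrapT => /negP/allZ.
  by rewrite -(actKV to1 g i) Zinv; apply: contrapT => /negP/allZ.
rewrite /S (bigD1 i) //= ltr_pwDl ?y_gt0 // sumr_ge0 // => k _; exact: y_ge0.
Qed.

(** Each column has maximum [0] and sum [-1]. *)
Let A i j := - (y i j / S j).

Let A_inv : invariant to1 to2 A.
Proof. by move=> g i j; rewrite /A y_inv S_inv. Qed.

Let A_le0 i j : A i j <= 0.
Proof. by rewrite oppr_le0 divr_ge0 ?y_ge0 ?ltW ?S_gt0. Qed.

Let A_Z i j : Z i j -> A i j = 0.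
Proof. by rewrite /A /y => ->; rewrite mul0r oppr0. Qed.

Let A_lt0 i j : ~~ Z i j -> A i j < 0.
Proof. by move=> /y_gt0 y0; rewrite oppr_lt0 divr_gt0 ?S_gt0. Qed.

Let A_sum j : \sum_i A i j = -1.
Proof. by rewrite sumrN -mulr_suml mulfV ?gt_eqF ?S_gt0. Qed.

Let A_col_inj_orbit j g : (forall i, A i j = A i (to2 j g)) -> j = to2 j g.
Proof.
move=> E; apply: sepY => i; apply: y_inj; have := E i; rewrite /A S_inv => /oppr_inj.
by apply: mulIf; rewrite invr_eq0 gt_eqF ?S_gt0.
Qed.

(** Equal columns have the same stabilizer, hence lie in one orbit. *)
Let A_col_inj j k : (forall i, A i j = A i k) -> j = k.
Proof.
suff stab j' k' g : (forall i, A i j' = A i k') -> to2 j' g = j' -> to2 k' g = k'.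
  move=> E; have [|g kE] := distY (x := j) (y := k).
    by move=> g; split; apply: stab => // i; rewrite E.
  by move: E; rewrite -kE => /A_col_inj_orbit.
move=> E jg; apply/esym/A_col_inj_orbit => i.
by rewrite -(actKV to1 g i) A_inv -!E -[in LHS]jg A_inv.
Qed.

Let A_row_inj_orbit i g : (forall j, A i j = A (to1 i g) j) -> i = to1 i g.
Proof.
move=> E; apply: sepX => j; have := E j; rewrite /A => /oppr_inj.
have Sj : (S j)^-1 != 0 by rewrite invr_eq0 gt_eqF ?S_gt0.
by move=> /(mulIf Sj) Eij; have := @y_inj i j (to1 i g) 1%g; rewrite act1; apply.
Qed.

(** The witness for column [j] is a row [i] where it has its maximum [0].  A
    column [k] with a negative entry there exceeds [j] in a row where [k] is [0];
    a column [k] which is also [0] in row [i] exceeds [j] somewhere because the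
    sums are equal. *)
Let A_irr_cols : irredundant_real (transpose A).
Proof.
move=> j; have [i Zij] := Zcol j; exists i => k kj; rewrite /transpose.
have [Zik|Zik] := boolP (Z i k).
  have [||l lt] := @exists_lt_of_eq_sum X (A^~ j) (A^~ k).
  - by rewrite !A_sum.
  - move=> E; move/eqP: kj; apply; apply/esym/A_col_inj => i'.
    exact: (congr1 (fun f => f i') E).
  by exists l; rewrite (A_Z Zij) (A_Z Zik) !addr0.
have [l Zlk] := Zcol k; exists l.
by rewrite (A_Z Zlk) (A_Z Zij) addr0 ltr_wnDl // A_lt0.
Qed.

(** The same argument; two rows with a common zero belong to one orbit, which
    gives them equal sums. *)
Let A_irr_rows : irredundant_real A.
Proof.
move=> i; have [j Zij] := Zrow i; exists j => k ki.
have [Zkj|Zkj] := boolP (Z k j).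
  have [g [gi _]] : same_orbit to1 to2 i j k j.
    by have := @Zone i j k 1%g Zij; rewrite act1; apply.
  have [||l lt] := @exists_lt_of_eq_sum Y (A i) (A k).
  - by rewrite -gi -[RHS](sum_act to2 g); apply: eq_bigr => l _; rewrite A_inv.
  - move=> E; move/eqP: ki; apply; rewrite -gi; apply/esym/A_row_inj_orbit => l.
    by rewrite gi E.
  by exists l; rewrite (A_Z Zij) (A_Z Zkj) !addr0.
have [l Zkl] := Zrow k; exists l.
by rewrite (A_Z Zkl) (A_Z Zij) addr0 ltr_wnDl // A_lt0.
Qed.

Lemma base_matrix_of_pattern : exists A : X -> Y -> R,
  [/\ invariant to1 to2 A, irredundant_real A & irredundant_real (transpose A)].
Proof. by exists A; split. Qed.

End FromPattern.

Lemma base_matrix : (#|O1| <= #|O2|)%N -> X ->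
  closed_pair to1 to2 -> no_fixed_point to2 -> distinct_orbits to2 ->
  exists A : X -> Y -> R,
  [/\ invariant to1 to2 A, irredundant_real A & irredundant_real (transpose A)].
Proof.
move=> leO x0 [f1 f2 closed] nofix dist.
have [Z [Zinv Zcol Zrow Zone]] := zero_pattern leO x0.
apply: (base_matrix_of_pattern Zinv Zcol Zrow Zone) => //.
  move=> i k ik; apply: (separated_columns f2 (pair_closed_swap closed)) => j.
  exact: same_orbit_swap.
exact: separated_columns.
Qed.

End Pattern.

End BaseMatrix.

(** * Generic invariant matrices have no further symmetries *)

Section Perturbation.
Variables (R : realType) (X Y : finType).
Local Open Scope ring_scope.
Local Notation V := (X -> Y -> R).

Definition shift (A v : V) (t : R) : V := fun i j => A i j + t * v i j.

(** Open along every ray; this weak openness is enough to leave the zero set of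
    a linear form and is stable under finite quantification. *)
Definition ray_open (P : V -> Prop) : Prop :=
  forall A v, P A -> exists2 e : R, 0 < e &
    forall t, 0 <= t -> t < e -> P (shift A v t).

Definition linear_form (L : V -> R) : Prop :=
  forall A v t, L (shift A v t) = L A + t * L v.

Lemma ray_open_and P Q : ray_open P -> ray_open Q -> ray_open (fun A => P A /\ Q A).
Proof.
move=> openP openQ A v [PA QA].
have [e e0 eP] := openP A v PA; have [e' e0' eQ] := openQ A v QA.
exists (Num.min e e'); first by rewrite lt_min e0.
by move=> t t0; rewrite lt_min => /andP[te te']; split; [apply: eP | apply: eQ].
Qed.

Lemma ray_open_exists (I : Type) (P : I -> V -> Prop) :
  (forall i, ray_open (P i)) -> ray_open (fun A => exists i, P i A).
Proof.
move=> openP A v [i PA]; have [e e0 eP] := openP i A v PA.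
by exists e => // t t0 te; exists i; apply: eP.
Qed.

Lemma ray_open_implies (C : Prop) P : ray_open P -> ray_open (fun A => C -> P A).
Proof.
move=> openP A v PA; have [c|nc] := pselect C; last by exists 1.
by have [e e0 eP] := openP A v (PA c); exists e => // t t0 te _; apply: eP.
Qed.

Lemma ray_open_forall (I : finType) (P : I -> V -> Prop) :
  (forall i, ray_open (P i)) -> ray_open (fun A => forall i, P i A).
Proof.
move=> openP; suff H (s : seq I) : ray_open (fun A => forall i, i \in s -> P i A).
  move=> A v PA; have [e e0 eP] := H (enum I) A v (fun i _ => PA i).
  by exists e => // t t0 te i; apply: eP; rewrite ?mem_enum.
elim: s => [|i s IH]; first by move=> A v _; exists 1.
move=> A v PA; have [|e e0 eP] := ray_open_and (openP i) IH (A := A) v.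
  split; first by apply: PA; rewrite mem_head.
  by move=> k ks; apply: PA; rewrite inE ks orbT.
exists e => // t t0 te k; have [Pi Ps] := eP t t0 te.
by rewrite inE => /orP[/eqP->|]; last exact: Ps.
Qed.

Lemma ray_open_gt0 L : linear_form L -> ray_open (fun A => 0 < L A).
Proof.
move=> linL A v LA; exists (L A / (`|L v| + 1)).
  by rewrite divr_gt0 // ltr_wpDl.
move=> t t0; rewrite ltr_pdivlMr ?ltr_wpDl // mulrDr mulr1 linL => te.
have : - (t * L v) <= t * `|L v| by rewrite -mulrN ler_wpM2l // -normrN ler_norm.
lra.
Qed.

Lemma ray_open_neq0 L : linear_form L -> ray_open (fun A => L A <> 0).
Proof.
move=> linL; have linN : linear_form (fun A => - L A).
  by move=> A v t; rewrite linL; lra.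
move=> A v /eqP; rewrite neq_lt => /orP[L0|L0].
  have [|e e0 eP] := ray_open_gt0 linN (A := A) v; first by rewrite oppr_gt0.
  by exists e => // t t0 te; have := eP t t0 te; lra.
have [|e e0 eP] := ray_open_gt0 linL (A := A) v; first by [].
by exists e => // t t0 te; have := eP t t0 te; lra.
Qed.

(** Finitely many linear forms which do not vanish identically on a space [W]
    are simultaneously nonzero at some point of any open subset of it. *)
Lemma generic_point (K : eqType) (W P : V -> Prop) (s : seq K) (L : K -> V -> R) A0 :
  (forall A v t, W A -> W v -> W (shift A v t)) -> ray_open P ->
  (forall k, linear_form (L k)) ->
  (forall k, k \in s -> exists2 v, W v & L k v <> 0) ->
  W A0 -> P A0 ->
  exists A, [/\ W A, P A & forall k, k \in s -> L k A <> 0].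
Proof.
move=> shiftW + linL; elim: s P A0 => [|k s IH] P A0 openP Lv WA PA.
  by exists A0; split.
have [v Wv Lkv] := Lv k (mem_head _ _).
have [A1 [WA1 PA1 LA1]] : exists A1, [/\ W A1, P A1 & L k A1 <> 0].
  have [L0|] := eqVneq (L k A0) 0; last by move/eqP; exists A0.
  have [e e0 eP] := openP A0 v PA; exists (shift A0 v (e / 2)); split.
  - exact: shiftW.
  - by apply: eP; lra.
  rewrite linL L0 add0r => /eqP; rewrite mulf_eq0 => /orP[|/eqP] //.
  by move=> /eqP; lra.
have [|A [WA' [PA' LA'] Ls]] := IH _ A1 (ray_open_and openP (ray_open_neq0 (linL k)))
  _ WA1 (conj PA1 LA1).
  by move=> k' k's; apply: Lv; rewrite inE k's orbT.
exists A; split=> // k'; rewrite inE => /orP[/eqP->|] //; exact: Ls.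
Qed.

Lemma ray_open_irredundant : ray_open (@irredundant_real R X Y).
Proof.
apply: ray_open_forall => i; apply: ray_open_exists => j.
apply: ray_open_forall => k; apply: ray_open_implies; apply: ray_open_exists => l.
pose L A : R := A k l + A i j - (A i l + A k j).
have linL : linear_form L by move=> A v t; rewrite /L /shift; lra.
move=> A v lt; have [|e e0 eP] := ray_open_gt0 linL (A := A) v.
  by rewrite /L subr_gt0.
by exists e => // t t0 te; have := eP t t0 te; rewrite /L subr_gt0.
Qed.

(** Up to a constant and a factor, [A] with its rows and columns recentered to
    have mean zero.  This removes the effect of scalings. *)
Definition centered (A : V) i j : R :=
  #|X|%:R * #|Y|%:R * A i j - #|X|%:R * (\sum_l A i l) - #|Y|%:R * (\sum_l A l j).

Lemma linear_centered i j : linear_form (fun A => centered A i j).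
Proof.
move=> A v t; rewrite /centered /shift !big_split /= -!mulr_sumr; lra.
Qed.

Lemma centered_aut (A : V) (s : X -> X) (u : Y -> Y) (d : X -> R) (e : Y -> R) :
  injective s -> injective u ->
  (forall i j, A (s i) (u j) = A i j + d i + e j) ->
  forall i j, centered A (s i) (u j) = centered A i j.
Proof.
move=> sI uI sE i j.
have row k : \sum_l A (s k) l = \sum_l A k l + #|Y|%:R * d k + \sum_l e l.
  rewrite (reindex_inj uI) /= (eq_bigr _ (fun l _ => sE k l)) !big_split /=.
  by rewrite sumr_const mulr_natl.
have col l : \sum_k A k (u l) = \sum_k A k l + \sum_k d k + #|X|%:R * e l.
  rewrite (reindex_inj sI) /= (eq_bigr _ (fun k _ => sE k l)) !big_split /=.
  by rewrite sumr_const mulr_natl.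
have tot : #|Y|%:R * (\sum_k d k) + #|X|%:R * (\sum_l e l) = 0.
  have : \sum_k \sum_l A k l = \sum_k \sum_l A (s k) l.
    by rewrite [LHS](reindex_inj sI).
  rewrite [RHS](eq_bigr _ (fun k _ => row k)) !big_split /= -mulr_sumr sumr_const.
  by rewrite -[X in _ = _ + X]mulr_natl => E; lra.
by rewrite /centered row col sE; lra.
Qed.

End Perturbation.

Lemma ray_open_irredundant_tr (R : realType) (X Y : finType) :
  ray_open (fun A : X -> Y -> R => irredundant_real (transpose A)).
Proof.
by move=> A v; apply: (@ray_open_irredundant R Y X (transpose A) (transpose v)).
Qed.

Section GenericMatrix.
Variable R : realType.
Variable G : finGroupType.
Local Open Scope ring_scope.

Lemma sum_le_card (Y : finType) (f : Y -> R) :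
  (forall l, f l <= 1) -> \sum_l f l <= #|Y|%:R.
Proof.
move=> f1; apply: (@le_trans _ _ (\sum_(l : Y) 1)); first exact: ler_sum.
by rewrite sumr_const.
Qed.

Lemma sum_eq_card (Y : finType) (f : Y -> R) :
  (forall l, f l <= 1) -> \sum_l f l = #|Y|%:R -> forall l, f l = 1.
Proof.
move=> f1 sumf l; apply/eqP; rewrite eq_sym -subr_eq0.
have /psumr_eq0P H : forall l : Y, true -> 0 <= 1 - f l.
  by move=> k _; rewrite subr_ge0.
by apply/eqP; apply: H => //; rewrite sumrB sumf sumr_const subrr.
Qed.

Section Separation.
Variables (X Y : finType) (to1 : {action G &-> X}) (to2 : {action G &-> Y}).
Local Notation same := (same_orbit to1 to2).

Definition orbit_indicator (i : X) (j : Y) : X -> Y -> R := fun i' j' => `[< same i j i' j' >]%:R.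

Local Notation ind := orbit_indicator.

Lemma invariant_indicator i j : invariant to1 to2 (ind i j).
Proof.
move=> g i' j'; rewrite /ind; congr (nat_of_bool _)%:R; apply: asbool_equiv_eq.
split=> H; last by apply: (same_orbit_trans H); apply: same_orbit_act.
by apply: (same_orbit_trans H); apply: same_orbit_sym; apply: same_orbit_act.
Qed.

Lemma indicator_eq1 i j i' j' : ind i j i' j' = 1 -> same i j i' j'.
Proof. by rewrite /ind; case: asboolP => // _ /eqP; rewrite eq_sym oner_eq0. Qed.

Lemma indicator_same i j i' j' : same i j i' j' -> ind i j i' j' = 1.
Proof. by move=> H; rewrite /ind asboolT. Qed.

Lemma indicator_neq i j i' j' : ~ same i j i' j' -> ind i j i' j' = 0.
Proof. by move=> H; rewrite /ind asboolF. Qed.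

Lemma indicator_le1 i j i' j' : ind i j i' j' <= 1.
Proof. by rewrite /ind; case: asboolP. Qed.

(** The orbit of [(i, j)] is the whole product of an orbit of rows with an orbit
    of columns. *)
Definition full_orbit i j : Prop := forall g, same i j i (to2 j g).

(** If the indicators of two orbits of pairs both failed to separate them, a
    count of their entries would show that the first orbit fills the product of
    the orbits of its row and of its column. *)
Lemma separate_orbits i j i' j' : ~ same i j i' j' -> ~ full_orbit i j ->
  exists2 v : X -> Y -> R, invariant to1 to2 v & centered v i j - centered v i' j' <> 0.
Proof.
move=> nsame nfull; apply: contrapT => none; apply: nfull.
have eqv a b : centered (ind a b) i j = centered (ind a b) i' j'.
  apply/eqP; rewrite -subr_eq0; apply: contrapT => /negP/eqP neq.
  by apply: none; exists (ind a b) => //; apply: invariant_indicator.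
have n0 : 0 < #|X|%:R :> R by rewrite ltr0n; apply/card_gt0P; exists i.
have m0 : 0 < #|Y|%:R :> R by rewrite ltr0n; apply/card_gt0P; exists j.
have nsame' : ~ same i' j' i j by move=> /same_orbit_sym.
have E1 := eqv i j; have E2 := eqv i' j'; move: E1 E2.
have i1 : ind i j i j = 1 by apply/indicator_same/same_orbit_refl.
have i2 : ind i j i' j' = 0 by apply: indicator_neq.
have i3 : ind i' j' i' j' = 1 by apply/indicator_same/same_orbit_refl.
have i4 : ind i' j' i j = 0 by apply: indicator_neq.
rewrite /centered {}i1 {}i2 {}i3 {}i4 !mulr0 !mulr1.
have [[g gi]|rowN] := pselect (exists g, to1 i g = i');
have [[h hj]|colN] := pselect (exists g, to2 j g = j').
- have rowE : \sum_l ind i j i' l = \sum_l ind i j i l.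
    by rewrite -gi -(sum_act to2 g); apply: eq_bigr => l _; apply: invariant_indicator.
  have colE : \sum_k ind i j k j' = \sum_k ind i j k j.
    by rewrite -hj -(sum_act to1 h); apply: eq_bigr => k _; apply: invariant_indicator.
  rewrite rowE colE => E _; have := mulr_gt0 n0 m0; lra.
- have rowE : \sum_l ind i j i' l = \sum_l ind i j i l.
    by rewrite -gi -(sum_act to2 g); apply: eq_bigr => l _; apply: invariant_indicator.
  have colE : \sum_k ind i j k j' = 0.
    by apply: big1 => k _; apply: indicator_neq => -[h [_ hj]]; apply: colN; exists h.
  rewrite rowE colE => E _ h.
  have sumE : \sum_k ind i j k j = #|X|%:R.
    by apply: (mulfI (lt0r_neq0 m0)); lra.
  have := sum_eq_card (fun k => indicator_le1 i j k j) sumE (to1 i h^-1%g).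
  move=> /indicator_eq1 H; apply: (same_orbit_trans H); exists h.
  by rewrite actKV.
- have rowE : \sum_l ind i j i' l = 0.
    by apply: big1 => k _; apply: indicator_neq => -[g [gi _]]; apply: rowN; exists g.
  have colE : \sum_k ind i j k j' = \sum_k ind i j k j.
    by rewrite -hj -(sum_act to1 h); apply: eq_bigr => k _; apply: invariant_indicator.
  rewrite rowE colE => E _ g.
  have sumE : \sum_l ind i j i l = #|Y|%:R.
    by apply: (mulfI (lt0r_neq0 n0)); lra.
  by have /indicator_eq1 := sum_eq_card (indicator_le1 i j i) sumE (to2 j g).
have rowN' : ~ exists g, to1 i' g = i.
  by move=> [g gi]; apply: rowN; exists g^-1%g; rewrite -gi actK.
have colN' : ~ exists g, to2 j' g = j.
  by move=> [g gi]; apply: colN; exists g^-1%g; rewrite -gi actK.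
have rowE : \sum_l ind i j i' l = 0.
  by apply: big1 => k _; apply: indicator_neq => -[g [gi _]]; apply: rowN; exists g.
have colE : \sum_k ind i j k j' = 0.
  by apply: big1 => k _; apply: indicator_neq => -[h [_ hj]]; apply: colN; exists h.
have rowE' : \sum_l ind i' j' i l = 0.
  by apply: big1 => k _; apply: indicator_neq => -[g [gi _]]; apply: rowN'; exists g.
have colE' : \sum_k ind i' j' k j = 0.
  by apply: big1 => k _; apply: indicator_neq => -[h [_ hj]]; apply: colN'; exists h.
rewrite {}rowE {}colE {}rowE' {}colE' => E1 E2 g.
pose f l := ind i j i l + ind i' j' i' l; pose f' k := ind i j k j + ind i' j' k j'.
have f1 l : f l <= 1.
  rewrite /f /ind; case: asboolP => [[a [_ aj]]|_]; case: asboolP => [[b [_ bj]]|_] //=; try lra.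
  by case: colN; exists (a * b^-1)%g; rewrite actM aj -bj actK.
have f'1 k : f' k <= 1.
  rewrite /f' /ind; case: asboolP => [[a [ai _]]|_]; case: asboolP => [[b [bi _]]|_] //=; try lra.
  by case: rowN; exists (a * b^-1)%g; rewrite actM ai -bi actK.
have leY := sum_le_card f1; have leX := sum_le_card f'1.
(* Adding the two counts leaves no room: every column lies in one of the two
   orbits. *)
have sumE : \sum_l f l = #|Y|%:R.
  apply: (mulfI (lt0r_neq0 n0)).
  have := ler_wpM2l (ltW n0) leY; have := ler_wpM2l (ltW m0) leX.
  by move: E1 E2; rewrite !big_split /=; lra.
have := sum_eq_card f1 sumE (to2 j g); rewrite /f [X in _ + X = _]indicator_neq.
  by rewrite addr0 => /indicator_eq1.
by move=> [a [_ aj]]; apply: colN; exists (g * a^-1)%g; rewrite actM -aj actK.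
Qed.

End Separation.

Variables (X Y : finType) (to1 : {action G &-> X}) (to2 : {action G &-> Y}).
Hypotheses (closed : closed_pair to1 to2) (G_neq1 : exists g : G, g != 1%g).
Hypotheses (tightX : no_fixed_point to1 /\ distinct_orbits to1)
  (tightY : no_fixed_point to2 /\ distinct_orbits to2).

Lemma faithful_nonempty (Z : finType) (to : {action G &-> Z}) :
  faithful_action to -> exists _ : Z, True.
Proof.
move=> faith; have [x _|Z0] := pickP (fun _ : Z => true); first by exists x.
by have [g /eqP[]] := G_neq1; apply: faith => x; have := Z0 x.
Qed.

(** The roles of rows and columns are exchanged if there are more orbits of
    rows. *)
Lemma base_matrix_exists : exists A : X -> Y -> R,
  [/\ invariant to1 to2 A, irredundant_real A & irredundant_real (transpose A)].
Proof.
have [f1 f2 _] := closed.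
have [x0 _] := faithful_nonempty f1; have [y0 _] := faithful_nonempty f2.
have [le|/ltnW le] := leqP #|[set orbit to1 [set: G] i | i : X]|
                           #|[set orbit to2 [set: G] j | j : Y]|.
  by have [? ?] := tightY; apply: base_matrix.
have [? ?] := tightX.
have [//|//|A [inv irr irrt]] := base_matrix R le y0 (closed_pair_swap closed).
by exists (transpose A); split=> // g i j; apply: inv.
Qed.

(** Every row and every column meets an orbit of pairs which is not full, so a
    bijection that preserves the orbits which are not full preserves them all. *)
Theorem rigid_matrix_exists : exists A : X -> Y -> R,
  [/\ invariant to1 to2 A, irredundant_real A, irredundant_real (transpose A) &
      forall (s : X -> X) (t : Y -> Y) (d : X -> R) (e : Y -> R),
        injective s -> injective t ->
        (forall i j, A (s i) (t j) = A i j + d i + e j) ->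
        exists g, (forall i, s i = to1 i g) /\ (forall j, t j = to2 j g)].
Proof.
have [A0 [inv0 irr0 irrt0]] := base_matrix_exists.
have [f1 f2 c12] := closed.
pose bad (k : (X * Y) * (X * Y)) := ~ same_orbit to1 to2 k.1.1 k.1.2 k.2.1 k.2.2 /\
  ~ full_orbit to1 to2 k.1.1 k.1.2.
pose L (k : (X * Y) * (X * Y)) (A : X -> Y -> R) :=
  centered A k.1.1 k.1.2 - centered A k.2.1 k.2.2.
have linL k : linear_form (L k).
  by move=> A v t; rewrite /L !linear_centered; lra.
have [|||A [inv [irr irrt] sep]] := @generic_point R X Y _ (invariant to1 to2)
  (fun A => irredundant_real A /\ irredundant_real (transpose A))
  [seq k <- enum {: (X * Y) * (X * Y)} | `[< bad k >]] L A0 _ _ linL _ inv0 (conj irr0 irrt0).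
- by move=> A v t invA invv g i j; rewrite /shift invA invv.
- by apply: ray_open_and; [apply: ray_open_irredundant | apply: ray_open_irredundant_tr].
- move=> k; rewrite mem_filter => /andP[/asboolP[k1 k2] _].
  exact: separate_orbits.
exists A; split=> // s t d e sI tI E.
have nonfull i j : ~ full_orbit to1 to2 i j -> same_orbit to1 to2 i j (s i) (t j).
  move=> nf; apply: contrapT => ns; apply: (sep ((i, j), (s i, t j))).
    by rewrite mem_filter mem_enum andbT; apply/asboolP.
  by rewrite /L /= (centered_aut sI tI E) subrr.
have rowNF i : exists j, ~ full_orbit to1 to2 i j.
  have [g gi] := tightX.1 i; apply: contrapT => /forallNP allf.
  move/eqP: gi; apply; apply/esym/(separated_columns f2 (pair_closed_swap c12)) => j.
  have /contrapT fullj := allf j; have [h [hi hj]] := fullj (g^-1)%g.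
  by exists (h * g)%g; rewrite !actM hi hj actKV.
have colNF j : exists i, ~ full_orbit to1 to2 i j.
  have [g gj] := tightY.1 j; apply: contrapT => /forallNP allf.
  move/eqP: gj; apply; apply/esym/(separated_columns f1 c12) => i.
  by have /contrapT := allf i; apply.
have pres i j : same_orbit to1 to2 i j (s i) (t j).
  have [full|/nonfull//] := pselect (full_orbit to1 to2 i j).
  have [j1 /nonfull[h [hi _]]] := rowNF i; have [i1 /nonfull[g [_ gj]]] := colNF j.
  have [a [ai aj]] := full (g * h^-1)%g.
  by exists (a * h)%g; rewrite !actM ai aj hi actM actKV gj.
have [g [g1 g2]] := c12 s t sI tI pres.
by exists g; split=> x; rewrite ?g1 ?g2.
Qed.

End GenericMatrix.

(** * Inequivalent blocks with prescribed symmetry *)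

Section Blocks.
Variable R : realType.
Local Open Scope ring_scope.
Local Notation T := (tropical R).

Definition cross (I J : Type) (A : I -> J -> R) i i' j j' : R :=
  A i j + A i' j' - (A i j' + A i' j).

(** The greatest cross difference of a finite matrix is invariant under scaling
    and permutations. *)
Definition max_cross (I J : finType) (B : I -> J -> T) (c : R) : Prop :=
  exists A : I -> J -> R, [/\ B = (fun i j => (A i j)%:T),
    exists i i' j j', cross A i i' j j' = c &
    forall i i' j j', cross A i i' j j' <= c].

Lemma max_cross_le (I J I' J' : finType) (B : I -> J -> T) (B' : I' -> J' -> T) c c' :
  mon_equiv B B' -> max_cross B c -> max_cross B' c' -> c <= c'.
Proof.
move=> [u [_ [g [e [_ ue]]]]] [A [BA [i [i' [j [j' <-]]]] _]] [A' [BA' _ max']].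
apply: le_trans (max' (u i).1 (u i').1 (g j) (g j')); rewrite /cross.
have E a b : (u a).2 + A' (u a).1 (g b) = A a b + e b.
  by have := ue a b; rewrite BA BA' !trop_mulE => -[].
have := E i j; have := E i' j'; have := E i j'; have := E i' j; lra.
Qed.

Lemma max_cross_equiv (I J I' J' : finType) (B : I -> J -> T) (B' : I' -> J' -> T) c c' :
  mon_equiv B B' -> max_cross B c -> max_cross B' c' -> c = c'.
Proof.
move=> BB' Bc Bc'; apply/eqP; rewrite eq_le (max_cross_le BB' Bc Bc').
exact: max_cross_le (mon_equiv_sym BB') Bc' Bc.
Qed.

(** A finite matrix is not equivalent to one with an infinite entry, and a
    positive cross difference needs two rows. *)
Lemma max_cross_not_tri (I J : finType) (B : I -> J -> T) k (t : R) c :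
  0 < c -> max_cross B c -> ~ mon_equiv B (@tri R k t).
Proof.
move=> c0 [A [BA [i [i' [j [j' cE]]]] _]] [u [[f uK uf] [g [e [gbij ue]]]]].
have fin a b : tri t (u a).1 (g b) != 0.
  by apply: contra_eq_neq (ue a b) => ->; rewrite mulr0 BA.
have [g' gK g'K] := gbij.
have le (a b : 'I_k) : (b <= a)%N.
  by have := fin (f a) (g' b); rewrite uf g'K tri_neq0.
have uii' : (u i).1 = (u i').1 by apply/val_inj/eqP; rewrite eqn_leq !le.
by move: c0; rewrite -cE /cross (can_inj uK uii') [X in _ < X - _]addrC subrr ltxx.
Qed.

Definition good_block (G : finGroupType) (I J : finType)
    (to1 : {action G &-> I}) (to2 : {action G &-> J}) (B : I -> J -> T) : Prop :=
  [/\ exists _ : I, True, irredundant B, irredundant (transpose B), connected_block B &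
      symmetry_group to1 to2 B].

Lemma max_exists (I : finType) (F : I -> R) (i0 : I) : exists i, forall k, F k <= F i.
Proof.
have [i _ maxi] := @Order.TotalTheory.arg_maxP _ _ I i0 predT F isT.
by exists i => k; apply: maxi.
Qed.

(** Two rows of an irredundant matrix have a positive cross difference, so a
    positive factor brings the greatest one to any given value. *)
Lemma block_of_closed_pair (G : finGroupType) (X Y : finType)
    (to1 : {action G &-> X}) (to2 : {action G &-> Y}) (c : R) :
  closed_pair to1 to2 -> (exists g : G, g != 1%g) -> 0 < c ->
  exists (X' Y' : finType) (to1' : {action G &-> X'}) (to2' : {action G &-> Y'})
         (B : X' -> Y' -> T),
    [/\ (#|X'| <= #|X|)%N, (#|Y'| <= #|Y|)%N, good_block to1' to2' B & max_cross B c].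
Proof.
move=> closed0 G_neq1 c_gt0.
have [X' [Y' [a1 [a2 [leX leY closed tightX tightY]]]]] := shrink_pair G_neq1 closed0.
have [A [inv irr irrt aut]] := rigid_matrix_exists R closed G_neq1 tightX tightY.
have [f1 f2 _] := closed.
have [x0 _] := faithful_nonempty G_neq1 f1; have [y0 _] := faithful_nonempty G_neq1 f2.
have [[[i i'] [j j']] cmax] := @max_exists ((X' * X') * (Y' * Y'))%type
  (fun q => cross A q.1.1 q.1.2 q.2.1 q.2.2) ((x0, x0), (y0, y0)).
have cr_gt0 : 0 < cross A i i' j j'.
  have [g gx] := tightX.1 x0; have [b irrb] := irr x0; have [l lt] := irrb _ gx.
  apply: lt_le_trans (cmax ((x0, a1 x0 g), (b, l))).
  by rewrite /cross /= subr_gt0 [ltRHS]addrC.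
pose t := c / cross A i i' j j'; have t_gt0 : 0 < t by rewrite divr_gt0.
pose tA a b := t * A a b.
have crossE a a' b b' : cross tA a a' b b' = t * cross A a a' b b'.
  by rewrite /cross /tA; ring.
have irr_scale (I J : finType) (C : I -> J -> R) :
    irredundant_real C -> irredundant_real (fun a b => t * C a b).
  move=> irrC a; have [b irrb] := irrC a; exists b => k ka.
  by have [l lt] := irrb _ ka; exists l; rewrite -!mulrDr ltr_pM2l.
exists X', Y', a1, a2, (fun a b => (tA a b)%:T); split=> //.
  split.
  - by exists x0.
  - by apply: irredundant_realP (irr_scale _ _ _ irr); apply/card_gt0P; exists y0.
  - by apply: irredundant_realP (irr_scale _ _ _ irrt); apply/card_gt0P; exists x0.
  - by move=> Z f g fg a a'; rewrite (fg a y0) // (fg a' y0).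
  split=> [g a b|//|s u d e sbij ubij E]; first by rewrite /tA inv.
  apply: (aut s u (fun a => - (d a / t)) (fun b => e b / t)).
  - exact: bij_inj.
  - exact: bij_inj.
  move=> a b; have [Eab] := E a b; rewrite /tA in Eab.
  apply: (mulfI (lt0r_neq0 t_gt0)).
  rewrite !mulrDr mulrN ![t * (_ / t)]mulrC !divfK ?gt_eqF //; lra.
exists tA; split=> //.
  by exists i, i', j, j'; rewrite crossE /t divfK // gt_eqF.
move=> a a' b b'; rewrite crossE /t mulrAC ler_pdivrMr // ler_pM2l //.
exact: (cmax ((a, a'), (b, b'))).
Qed.

Lemma good_block_tri (G : finGroupType) k (t : R) : #|G| = 1%N -> (0 < k)%N ->
  good_block (trivial_action G 'I_k) (trivial_action G 'I_k) (@tri R k t).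
Proof.
move=> G1 k0; split.
- by exists (Ordinal k0).
- exact: irredundant_tri.
- exact: irredundant_tri_tr.
- exact: connected_tri.
exact: symmetry_group_tri.
Qed.

Lemma closed_pair_of_points (G : finGroupType) n m :
  paired_2closed_on_points G n m ->
  exists (X Y : finType) (to1 : {action G &-> X}) (to2 : {action G &-> Y}),
    [/\ #|X| = n, #|Y| = m & closed_pair to1 to2].
Proof.
move=> [X [Y [to1 [to2 [nE mE /faithfulP f1 /faithfulP f2 closed]]]]].
exists X, Y, to1, to2; split=> //; split; last exact: paired_2closedP.
  by move=> g fixg; apply: f1; rewrite ?inE // => x _; apply: fixg.
by move=> g fixg; apply: f2; rewrite ?inE // => x _; apply: fixg.
Qed.

Lemma group_neq1_exists (G : finGroupType) : #|G| != 1%N -> exists g : G, g != 1%g.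
Proof.
move=> G1; apply: contrapT => /forallNP all1; move/eqP: G1; apply.
apply: (@eq_card1 _ 1%g) => g; rewrite !inE.
by apply/esym/eqP; apply: contrapT => /eqP g1; apply: (all1 g).
Qed.

Section Choice.
Variables (z : nat) (G : 'I_z -> finGroupType) (n_ m_ : 'I_z -> nat).
Hypotheses (n_gt0 : forall a, (0 < n_ a)%N) (m_gt0 : forall a, (0 < m_ a)%N)
  (closed : forall a, paired_2closed_on_points (G a) (n_ a) (m_ a))
  (unit1 : forall a b, minn (n_ a) (m_ a) = 1%N -> minn (n_ b) (m_ b) = 1%N -> a = b)
  (trivial3 : forall a1 a2 a3 : 'I_z, a1 != a2 -> a1 != a3 -> a2 != a3 ->
     #|G a1| = 1%N -> #|G a2| = 1%N -> #|G a3| = 1%N ->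
     exists2 a, a \in [:: a1; a2; a3] & (2 < minn (n_ a) (m_ a))%N).

Let mn a := minn (n_ a) (m_ a).
Let small a := (#|G a| == 1%N) && (mn a <= 2)%N.

(** Among the trivial groups on few points there are at most two; if there are
    two of them, one gets the unit block and the other, with room for it, the
    triangular block of size two. *)
Definition tri_size a : nat :=
  if (2 < mn a)%N then 3
  else if (mn a == 2%N) && [exists b, [&& small b, b != a & (mn b == 1%N) || (b < a)%N]]
  then 2 else 1.

Lemma tri_size_gt0 a : (0 < tri_size a)%N.
Proof. by rewrite /tri_size; case: ifP => // _; case: ifP. Qed.

Lemma tri_size_le a : (tri_size a <= mn a)%N.
Proof.
rewrite /tri_size; case: ifP => // _; case: ifP => [/andP[/eqP-> _]|_] //.
by rewrite /mn leq_min n_gt0 m_gt0.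
Qed.

Lemma tri_size_inj a b : #|G a| = 1%N -> #|G b| = 1%N ->
  tri_size a = tri_size b -> (tri_size a = 3 -> a = b) -> a = b.
Proof.
move=> Ga Gb; rewrite /tri_size.
have [a2|a2] := ltnP 2 (mn a); have [b2|b2] := ltnP 2 (mn b); try by [case: ifP|move=> _; apply].
move=> + _; have smalla : small a by rewrite /small Ga a2.
have smallb : small b by rewrite /small Gb b2.
have only c : a != b -> small c -> (c == a) || (c == b).
  move=> ab /andP[/eqP Gc c2]; apply: contraT; rewrite negb_or => /andP[ca cb].
  have [||c'] := trivial3 (a1 := a) (a2 := b) (a3 := c) ab _ _ Ga Gb Gc; rewrite 1?eq_sym //.
  by rewrite !inE => /or3P[]/eqP->; rewrite ltnNge -/(mn _) ?a2 ?b2 ?c2.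
have min1 c : small c -> mn c != 2%N -> mn c = 1%N.
  move=> /andP[_]; have : (0 < mn c)%N by rewrite /mn leq_min n_gt0 m_gt0.
  by case: (mn c) => [|[|[|]]].
case: ifPn => [/andP[/eqP ma /existsP[c /and3P[sc ca mc]]]|Na];
  case: ifPn => [/andP[/eqP mb /existsP[c' /and3P[sc' cb mc']]]|Nb] // _;
  apply/eqP; apply: contraT => ab.
  have Ec : c = b by have := only c ab sc; rewrite (negPf ca) => /eqP.
  have Ec' : c' = a by have := only c' ab sc'; rewrite (negPf cb) orbF => /eqP.
  move: mc mc'; rewrite Ec Ec' ma mb /= => lt lt'.
  by have := ltn_trans lt lt'; rewrite ltnn.
have [ma|ma] := eqVneq (mn a) 2%N; have [mb|mb] := eqVneq (mn b) 2%N.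
- move: Na Nb; rewrite ma mb !eqxx /= => /existsPn Na /existsPn Nb.
  have := Na b; have := Nb a; rewrite smalla smallb ab (eq_sym b) ab ma mb /= -!leqNgt => l1 l2.
  by case/eqP: ab; apply/val_inj/eqP; rewrite eqn_leq l1 l2.
- by move: Na; rewrite ma eqxx /= => /existsPn /(_ b); rewrite smallb eq_sym ab min1.
- by move: Nb; rewrite mb eqxx /= => /existsPn /(_ a); rewrite smalla ab min1.
by case/eqP: ab; apply: unit1; apply: min1.
Qed.

Record block (H : finGroupType) := Block {
  block_row : finType;
  block_col : finType;
  block_act1 : {action H &-> block_row};
  block_act2 : {action H &-> block_col};
  block_mx : block_row -> block_col -> T }.

Lemma blocks_exist : exists b : forall a, block (G a),
  (forall a, [/\ (#|block_row (b a)| <= n_ a)%N, (#|block_col (b a)| <= m_ a)%N &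
     good_block (@block_act1 _ (b a)) (@block_act2 _ (b a)) (@block_mx _ (b a))]) /\
  (forall a a', mon_equiv (@block_mx _ (b a)) (@block_mx _ (b a')) -> a = a').
Proof.
(* The index [a] is the invariant which tells blocks of the same sort apart. *)
pose kind a (b : block (G a)) : Prop :=
  if #|G a| == 1%N then mon_equiv (@block_mx _ b) (@tri R (tri_size a) a%:R)
  else max_cross (@block_mx _ b) a.+1%:R.
have ex a : exists b : block (G a),
    [/\ (#|block_row b| <= n_ a)%N, (#|block_col b| <= m_ a)%N,
     good_block (@block_act1 _ b) (@block_act2 _ b) (@block_mx _ b) & kind a b].
  have [Ga|Ga] := eqVneq #|G a| 1%N.
    exists (@Block (G a) _ _ (trivial_action (G a) 'I_(tri_size a))
      (trivial_action (G a) 'I_(tri_size a)) (tri a%:R)).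
    have := tri_size_le a; rewrite /mn leq_min => /andP[len lem].
    split; rewrite /= ?card_ord //; first exact: good_block_tri (tri_size_gt0 a).
    by rewrite /kind Ga eqxx; apply: mon_equiv_refl.
  have [X [Y [to1 [to2 [nE mE cl]]]]] := closed_pair_of_points (closed a).
  have [|X' [Y' [a1 [a2 [B [leX leY good cross]]]]]] :=
    @block_of_closed_pair _ _ _ to1 to2 a.+1%:R cl (group_neq1_exists Ga); first by rewrite ltr0n.
  by exists (Block a1 a2 B); split; rewrite -?nE -?mE // /kind (negPf Ga).
have [b bP] := dep_choice ex; exists b; split; first by move=> a; have [] := bP a.
move=> a a' equiv; have [_ _ _] := bP a; have [_ _ _] := bP a'; rewrite /kind.
have pos (c : 'I_z) : 0 < c.+1%:R :> R by rewrite ltr0n.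
case: eqVneq => [Ga'|_]; case: eqVneq => [Ga|_].
- move=> ta' ta; have := mon_equiv_trans (mon_equiv_sym ta) (mon_equiv_trans equiv ta').
  move=> /tri_equiv[kE tE]; apply: tri_size_inj => // /tE /eqP.
  by rewrite eqr_nat => /eqP/val_inj.
- move=> ta' ca; case: (max_cross_not_tri (pos a) ca (mon_equiv_trans equiv ta')).
- move=> ca' ta.
  by case: (max_cross_not_tri (pos a') ca' (mon_equiv_trans (mon_equiv_sym equiv) ta)).
move=> ca' /(max_cross_equiv equiv) /(_ ca') /eqP.
by rewrite eqr_nat => /eqP [] /val_inj.
Qed.

End Choice.

End Blocks.

(** * The classification *)

Section Assembly.
Variable R : realType.
Local Open Scope ring_scope.
Local Notation T := (tropical R).

Lemma pad_matrix (n m p k : nat) (B : 'M[T]_(p, k)) : (p <= n)%N -> (k <= m)%N ->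
  exists (A : 'M[T]_(n, m)) (P : 'M[T]_(p, n)) (Q : 'M[T]_(m, k))
         (U : 'M[T]_(n, p)) (V : 'M[T]_(k, m)),
    [/\ U *m P *m A = A, A *m Q *m V = A & P *m A *m Q = B].
Proof.
move=> pn km.
pose E (a b : nat) (le : (a <= b)%N) : 'M[T]_(a, b) :=
  \matrix_(i, r) (r == widen_ord le i)%:R.
have EE a b (le : (a <= b)%N) : E a b le *m (E a b le)^T = 1%:M.
  apply/matrixP => i j; rewrite !mxE (bigD1 (widen_ord le i)) //= big1 ?addr0.
    by rewrite !mxE eqxx mul1r; congr (_%:R).
  by move=> r ri; rewrite !mxE (negPf ri) mul0r.
exists ((E p n pn)^T *m B *m E k m km), (E p n pn), (E k m km)^T, (E p n pn)^T, (E k m km).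
split; rewrite -!mulmxA.
- by rewrite (mulmxA (E p n pn)) EE mul1mx.
- by rewrite (mulmxA _ _ (E k m km)) EE mul1mx.
by rewrite EE mulmx1 mulmxA EE mul1mx.
Qed.

Lemma mon_equiv_dsum (L : finType) (Om Ga Om' Ga' : L -> finType)
    (A : forall l, Om l -> Ga l -> T) (B : forall l, Om' l -> Ga' l -> T) :
  (forall l, mon_equiv (A l) (B l)) -> mon_equiv (dsum A) (dsum B).
Proof.
move=> equiv; have [u uP] := dep_choice equiv.
have [g gP] := dep_choice (fun l => (uP l).2); have [e eP] := dep_choice gP.
have tagged_bij (X Y : L -> finType) (f : forall l, X l -> Y l) :
    (forall l, bijective (f l)) ->
    bijective (fun p : {l & X l} => Tagged (fun l => Y l) (f (tag p) (tagged p))).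
  move=> fbij; apply: inj_surj_bij => [[l x] [l' x'] E|[l y]].
    have ll' : l = l' := congr1 tag E; subst l'.
    by have /= /(bij_inj (fbij l)) -> := Tagged_inj E.
  have [f' _ fK] := fbij l.
  by exists (Tagged (fun l => X l) (f' y)); rewrite /= fK.
exists (fun p => (Tagged (fun l => Om' l) (u (tag p) (tagged p)).1, (u (tag p) (tagged p)).2)).
split; first exact: (tagged_bij _ _ (fun l i => (u l i).1) (fun l => (uP l).1)).
exists (fun q => Tagged (fun l => Ga' l) (g (tag q) (tagged q))), (fun q => e (tag q) (tagged q)).
split; first exact: (tagged_bij _ _ _ (fun l => (eP l).1)).
move=> [l i] [l' j] /=; have [ll'|ll'] := eqVneq l l'.
  by subst l'; rewrite (dsum_same B (u l i).1 (g l j)) (dsum_same A i j) (eP l).2.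
rewrite (_ : dsum B _ _ = 0) ?mulr0; last first.
  by apply: contraNeq ll' => /dsum_neq0 /= ->.
by rewrite (_ : dsum A _ _ = 0) ?mul0r //; apply: contraNeq ll' => /dsum_neq0 /= ->.
Qed.

(** The rows of [h a] copies of each block, counted by type. *)
Lemma card_tagged_copies (z : nat) (h : 'I_z -> nat) (Om : 'I_z -> finType) :
  #|{: {l : {a : 'I_z & 'I_(h a)} & Om (tag l)}}| = (\sum_a #|Om a| * h a)%N.
Proof.
rewrite card_tagged sumnE big_map big_enum /=.
rewrite -(@sig_big_dep _ _ _ _ (fun a => 'I_(h a)) xpredT (fun=> xpredT) (fun a _ => #|Om a|)).
by apply: eq_bigr => a _; rewrite sum_nat_const card_ord mulnC.
Qed.

Lemma schutzenberger0 (n m : nat) : (0 < n)%N -> (0 < m)%N ->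
  forall x : schutzenberger (0 : 'M[T]_(n, m)), x = 1%g.
Proof.
move=> n0 m0 x.
have H0 (y : Hclass (0 : 'M[T]_(n, m))) : \val y = 0.
  have [/(greenR_mul _ _ m0 m0)[_ [Y ->]] _] := set_mem (valP y).
  by rewrite mul0mx.
by apply: val_inj; apply/funext => y; apply: val_inj; rewrite !H0.
Qed.

Section Wreath.
Variables (z : nat) (h : 'I_z -> nat) (G : 'I_z -> finGroupType).
Variables (Om Ga : 'I_z -> finType).
Variables (to1 : forall a, {action G a &-> Om a}) (to2 : forall a, {action G a &-> Ga a}).
Variable B : forall a, Om a -> Ga a -> T.
Hypothesis good : forall a, good_block (to1 a) (to2 a) (B (a := a)).
Hypothesis inequiv : forall a b, mon_equiv (B (a := a)) (B (a := b)) -> a = b.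

Local Notation D := (dsum (fun l : {a : 'I_z & 'I_(h a)} => @B (tag l))).

Lemma good_blocks_aut_group : is_aut_group
  (direct_prod_of (fun a => wreath (Algebra.to_multiplicative R * G a)%type (h a))) D.
Proof.
have [i0 _] := dep_choice (fun a => let: And5 e _ _ _ _ := good a in e).
have conn a : connected_block (B (a := a)) by have [] := good a.
have col a (j : Ga a) : exists i, B i j != 0.
  by have [_ _ irrt _ _] := good a; have := irredundant_row_neq0 irrt j.
have symB a : symmetry_group (to1 a) (to2 a) (B (a := a)) by have [] := good a.
exact: (wreath_aut_group h i0 conn col symB inequiv).
Qed.

Lemma good_blocks_irredundant : irredundant D /\ irredundant (transpose D).
Proof.
rewrite transpose_dsum; split; apply: irredundant_dsum.
- by move=> l i; have [_ irr _ _ _] := good (tag l); apply: irredundant_row_neq0.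
- by move=> l; have [] := good (tag l).
- by move=> l i; have [_ _ irrt _ _] := good (tag l); apply: irredundant_row_neq0.
by move=> l; have [] := good (tag l).
Qed.

End Wreath.

Section Statement.
Variables (n m : nat) (n_gt0 : (0 < n)%N) (m_gt0 : (0 < m)%N).

Lemma schutzenberger_of_irredundant (I J : finType) (B : I -> J -> T) (i0 : I)
    (K : groupType) :
  (#|I| <= n)%N -> (#|J| <= m)%N -> irredundant B -> irredundant (transpose B) ->
  is_aut_group K B ->
  exists2 A : 'M[T]_(n, m), A != 0 & isomorphic (schutzenberger A) K.
Proof.
move=> leI leJ irrB irrBt KB.
pose B0 : 'M[T]_(#|I|, #|J|) := \matrix_(i, j) B (enum_val i) (enum_val j).
have B0E : (B0 : _ -> _ -> _) = fun i j => B (enum_val i) (enum_val j).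
  by apply/funext => i; apply/funext => j; rewrite mxE.
have equiv : mon_equiv B0 B.
  rewrite B0E; apply: relabel_equiv; first exact: enum_val_bij.
  exact: enum_val_bij.
have irrB0 : irredundant B0 by apply: irredundant_equiv (mon_equiv_sym equiv) irrB.
have irrB0t : irredundant (transpose B0).
  exact: irredundant_equiv (mon_equiv_transpose (mon_equiv_sym equiv)) irrBt.
have [A [P [Q [U [V [UPA AQV BE]]]]]] := pad_matrix B0 leI leJ.
exists A.
  have [j [nz _]] := irrB0 (enum_rank i0).
  by apply: contraNneq nz => A0; rewrite -BE A0 mulmx0 mul0mx mxE.
apply: is_aut_group_isomorphic (is_aut_group_equiv equiv KB).
exact: (schutzenberger_aut_group n_gt0 m_gt0 UPA AQV BE irrB0 irrB0t).
Qed.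

Lemma irredundant_of_schutzenberger (A : 'M[T]_(n, m)) : A != 0 ->
  exists (p k : nat) (B : 'M[T]_(p, k)),
    [/\ [/\ 0 < p, p <= n & k <= m]%N, irredundant B, irredundant (transpose B) &
        is_aut_group (schutzenberger A) B].
Proof.
move=> A0; have [p [k [P [Q [U [V [pn km UPA AQV [irrB irrBt]]]]]]]] := reduction_exists A.
exists p, k, (P *m A *m Q); split=> //; last exact: (schutzenberger_aut_group _ _ UPA AQV).
split=> //; case: p P U {pn irrB irrBt} UPA => // P U UPA; case/eqP: A0.
by rewrite -UPA; apply/matrixP => i j; rewrite -mulmxA !mxE big_ord0.
Qed.

End Statement.

Record symmetrized (X Y : finType) := Symmetrized {
  sym_type : finGroupType;
  sym_to1 : {action sym_type &-> X};
  sym_to2 : {action sym_type &-> Y};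
  sym_mx : X -> Y -> T }.

(** Replacing each block by its normalisation changes the matrix only by
    scalings. *)
Lemma decompose (I J : finType) (B : I -> J -> T) :
  irredundant B -> irredundant (transpose B) ->
  exists (z : nat) (h : 'I_z -> nat) (G : 'I_z -> finGroupType) (Om Ga : 'I_z -> finType)
     (to1 : forall a, {action G a &-> Om a}) (to2 : forall a, {action G a &-> Ga a})
     (C : forall a, Om a -> Ga a -> T),
  [/\ forall a, (0 < h a)%N, mon_equiv (dsum (fun l : {a : 'I_z & 'I_(h a)} => C (tag l))) B,
      forall a b, mon_equiv (C a) (C b) -> a = b,
      forall a, good_block (to1 a) (to2 a) (C a) &
      forall a, [/\ [faithful [set: G a], on [set: Om a] | to1 a],
                    [faithful [set: G a], on [set: Ga a] | to2 a] &
                    paired_2closed (to1 a) (to2 a)]].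
Proof.
move=> irrB irrBt.
have [z [h [Om [Ga [A [h_gt0 equiv ineq blk]]]]]] := block_decomposition irrB irrBt.
have ex a : exists S : symmetrized (Om a) (Ga a),
    [/\ mon_equiv (sym_mx S) (A a), symmetry_group (sym_to1 S) (sym_to2 S) (sym_mx S),
        [faithful [set: sym_type S], on [set: Om a] | sym_to1 S],
        [faithful [set: sym_type S], on [set: Ga a] | sym_to2 S] &
        paired_2closed (sym_to1 S) (sym_to2 S)].
  have [_ _ irr irrt] := blk a; have [G [to1 [to2 [C CP]]]] := symmetrize irr irrt.
  by exists (Symmetrized to1 to2 C).
have [S SP] := dep_choice ex.
have CA a : mon_equiv (sym_mx (S a)) (A a) by have [] := SP a.
exists z, h, (fun a => sym_type (S a)), Om, Ga, (fun a => sym_to1 (S a)),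
  (fun a => sym_to2 (S a)), (fun a => sym_mx (S a)); split=> //.
- apply: mon_equiv_trans equiv; apply: mon_equiv_dsum => l; exact: CA.
- move=> a b ab; apply: ineq.
  by apply: mon_equiv_trans (CA b); apply: mon_equiv_trans ab; apply: mon_equiv_sym.
- move=> a; have [/card_gt0P[i _] conn irr irrt] := blk a.
  have AC := mon_equiv_sym (CA a); split; last by have [] := SP a.
  + by exists i.
  + exact: irredundant_equiv AC irr.
  + exact: irredundant_equiv (mon_equiv_transpose AC) irrt.
  exact: connected_equiv AC conn.
by move=> a; have [] := SP a.
Qed.

(** If the smaller dimension is 1 both blocks are single entries; if it is 2 and
    the groups are trivial both are equivalent to [corner]. *)
Lemma small_trivial_equiv (G G' : finGroupType) (I J I' J' : finType)
    (to1 : {action G &-> I}) (to2 : {action G &-> J}) (B : I -> J -> T)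
    (to1' : {action G' &-> I'}) (to2' : {action G' &-> J'}) (B' : I' -> J' -> T) :
  good_block to1 to2 B -> good_block to1' to2' B' ->
  minn #|I| #|J| = minn #|I'| #|J'| ->
  minn #|I| #|J| = 1%N \/ [/\ #|G| = 1%N, #|G'| = 1%N & (minn #|I| #|J| <= 2)%N] ->
  mon_equiv B B'.
Proof.
move=> [[i _] irr irrt conn sym] [_ irr' irrt' conn' sym'] EE small.
have [j _] := irredundant_row_neq0 irr i.
have I0 : (0 < #|I|)%N by apply/card_gt0P; exists i.
have J0 : (0 < #|J|)%N by apply/card_gt0P; exists j.
have le2 : (minn #|I| #|J| <= 2)%N by case: small => [->|[]].
have IJ := small_block_card irr irrt le2.
have IJ' : #|I'| = #|J'| by apply: (small_block_card irr' irrt'); rewrite -EE.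
have [min1|min1] := eqVneq (minn #|I| #|J|) 1%N.
  have I1 : #|I| = 1%N by move: min1; rewrite -IJ minnn.
  have I1' : #|I'| = 1%N by move: min1; rewrite EE -IJ' minnn.
  by apply: unit_block_equiv; rewrite -?IJ -?IJ'.
have min2 : minn #|I| #|J| = 2%N.
  have : (0 < minn #|I| #|J|)%N by rewrite leq_min I0.
  by move: le2 min1; case: minn => [|[|[]]].
case: small => [min1'|[G1 G1' _]]; first by rewrite min1' in min1.
have e := rigid_two_block irr irrt conn (rigid_symmetry_group G1 sym) min2.
have min2' : minn #|I'| #|J'| = 2%N by rewrite -EE.
have e' := rigid_two_block irr' irrt' conn' (rigid_symmetry_group G1' sym') min2'.
exact: mon_equiv_trans e (mon_equiv_sym e').
Qed.

End Assembly.

Theorem theorem6p3 (R : realType) (n m : nat) (n_gt0 : (0 < n)%N) (m_gt0 : (0 < m)%N) :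
  (forall K : groupType,
    (exists2 A : 'M[tropical R]_(n, m),
       A != 0%R & isomorphic (schutzenberger A) K)
    <->
    (exists (z : nat) (h : 'I_z -> nat) (G : 'I_z -> finGroupType)
            (n_ m_ : 'I_z -> nat),
      [/\ (0 < z)%N,
          (forall a, [/\ 0 < h a, 0 < n_ a & 0 < m_ a])%N &
          isomorphic
            (direct_prod_of
               (fun a => wreath (Algebra.to_multiplicative R * G a)%type (h a))) K] /\
      [/\ (\sum_(a < z) n_ a * h a <= n)%N,
          (\sum_(a < z) m_ a * h a <= m)%N,
          (forall a, paired_2closed_on_points (G a) (n_ a) (m_ a)),
          (forall a b, minn (n_ a) (m_ a) = 1%N -> minn (n_ b) (m_ b) = 1%N ->
             a = b) &
          (forall a1 a2 a3 : 'I_z, a1 != a2 -> a1 != a3 -> a2 != a3 ->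
             #|G a1| = 1%N -> #|G a2| = 1%N -> #|G a3| = 1%N ->
             exists2 a, a \in [:: a1; a2; a3] & (2 < minn (n_ a) (m_ a))%N)]))
  /\ (forall x : schutzenberger (0%R : 'M[tropical R]_(n, m)), x = 1%g).
Proof.
split; last exact: schutzenberger0.
move=> K; split=> [[A A0 isoK]|].
  have [p [k [B [[p0 pn km] irr irrt SB]]]] := irredundant_of_schutzenberger n_gt0 m_gt0 A0.
  have [z [h [G [Om [Ga [to1 [to2 [C [h_gt0 equiv ineq good paired]]]]]]]]] :=
    decompose irr irrt.
  have KC := is_aut_group_equiv equiv (is_aut_group_transfer SB isoK).
  have [u [ubij [g [e [gbij _]]]]] := equiv.
  exists z, h, G, (fun a => #|Om a|), (fun a => #|Ga a|); split; split.
  - have [f _ _] := ubij.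
    exact: leq_ltn_trans (leq0n _) (ltn_ord (tag (tag (f (Ordinal p0))))).
  - move=> a; have [[i _] irra _ _ _] := good a; have [j _] := irredundant_row_neq0 irra i.
    by split=> //; apply/card_gt0P; [exists i | exists j].
  - exact: is_aut_group_isomorphic (good_blocks_aut_group h good ineq) KC.
  - by rewrite -card_tagged_copies (bij_eq_card ubij) card_ord.
  - by rewrite -card_tagged_copies (bij_eq_card gbij) card_ord.
  - by move=> a; exists (Om a), (Ga a), (to1 a), (to2 a); have [] := paired a.
  - move=> a b ma mb; apply/ineq/(small_trivial_equiv (good a) (good b)); last by left.
    by rewrite ma mb.
  move=> a1 a2 a3 a12 a13 a23 G1 G2 G3.
  apply: contrapT => none.
  have small a : a \in [:: a1; a2; a3] ->
      minn #|Om a| #|Ga a| = 1%N \/ minn #|Om a| #|Ga a| = 2%N.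
    move=> ain; have : ~ (2 < minn #|Om a| #|Ga a|)%N by move=> lt; apply: none; exists a.
    move=> /negP; rewrite -leqNgt.
    have [[i _] irra _ _ _] := good a; have [j _] := irredundant_row_neq0 irra i.
    have : (0 < minn #|Om a| #|Ga a|)%N.
      by rewrite leq_min; apply/andP; split; apply/card_gt0P; [exists i | exists j].
    by case: minn => [|[|[]]] //; [left | right].
  have same a b : #|G a| = 1%N -> #|G b| = 1%N ->
      minn #|Om a| #|Ga a| = minn #|Om b| #|Ga b| -> (minn #|Om a| #|Ga a| <= 2)%N -> a = b.
    move=> Ga1 Gb1 ab le2; apply/ineq/(small_trivial_equiv (good a) (good b)) => //.
    by right.
  have := small a1; have := small a2; have := small a3; rewrite !inE !eqxx ?orbT.
  move=> /(_ isT) s3 /(_ isT) s2 /(_ isT) s1.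
  case: s1 => s1; case: s2 => s2; case: s3 => s3;
    first [ by case/eqP: a12; apply: same; rewrite ?s1 ?s2
          | by case/eqP: a13; apply: same; rewrite ?s1 ?s3
          | by case/eqP: a23; apply: same; rewrite ?s2 ?s3 ].
move=> [z [h [G [n_ [m_ [[z0 pos isoK] [sumn summ paired unit1 trivial3]]]]]]].
have n_gt a : (0 < n_ a)%N by have [] := pos a.
have m_gt a : (0 < m_ a)%N by have [] := pos a.
have [b [bP ineq]] := blocks_exist R n_gt m_gt paired unit1 trivial3.
have good a : good_block (@block_act1 _ _ (b a)) (@block_act2 _ _ (b a)) (@block_mx _ _ (b a)).
  by have [] := bP a.
pose a0 : 'I_z := Ordinal z0.
have h0 : (0 < h a0)%N by have [] := pos a0.
have [[i0 _] _ _ _ _] := good a0.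
have [irr irrt] := good_blocks_irredundant h good.
apply: (schutzenberger_of_irredundant n_gt0 m_gt0 _ _ _ irr irrt).
- exact: (Tagged (fun l : {a : 'I_z & 'I_(h a)} => block_row (b (tag l)))
    (i := Tagged (fun a => 'I_(h a)) (Ordinal h0)) i0).
- rewrite (card_tagged_copies h (fun a => block_row (b a))) (leq_trans _ sumn) // leq_sum // => a _.
  by rewrite leq_mul2r; have [-> _ _] := bP a; rewrite orbT.
- rewrite (card_tagged_copies h (fun a => block_col (b a))) (leq_trans _ summ) // leq_sum // => a _.
  by rewrite leq_mul2r; have [_ -> _] := bP a; rewrite orbT.
exact: is_aut_group_transfer (good_blocks_aut_group h good ineq) isoK.
Qed.
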